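(* Let $H$ be a complex Hilbert space, let $T$ be a closed (possibly unbounded) linear operator in $H$ with domain $D(T)$, and let $M$ and $N$ be (possibly unbounded) normal operators in $H$ with domains $D(M)$ and $D(N)$ respectively. If $D(N)\subset D(T)$, then $TN\subset MT$ implies $TN^*\subset M^*T$.
   Context: A densely defined closed operator $N$ is normal if $NN^*=N^*N$ (including equality of domains). For linear operators $S,R$, the product $SR$ is defined on $D(SR)=\{x\in D(R): Rx\in D(S)\}$ by $(SR)x=S(Rx)$. For operators $S_1,S_2$, $S_1\subset S_2$ means $D(S_1)\subset D(S_2)$ and $S_2x=S_1x$ for all $x\in D(S_1)$. *)

(* Defs.v *)
From HB Require Import structures.
From mathcomp Require Import all_boot all_order all_algebra.
From mathcomp Require Import reals complex.
From Stdlib Require Import ClassicalEpsilon.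

Set Implicit Arguments.
Unset Strict Implicit.
Unset Printing Implicit Defensive.

Import Order.TTheory GRing.Theory Num.Theory.
Local Open Scope ring_scope.

Record inner_product (R : realType) (H : lmodType R[i]) := InnerProduct {
  ip : H -> H -> R[i];
  ip_linl : forall (a : R[i]) (x y z : H), ip (a *: x + y) z = a * ip x z + ip y z;
  ip_conj : forall x y : H, ip x y = Num.conj (ip y x);
  ip_ge0 : forall x : H, 0 <= ip x x;
  ip_eq0 : forall x : H, ip x x = 0 -> x = 0
}.

Definition hnorm (R : realType) (H : lmodType R[i]) (I : inner_product H) (x : H) : R :=
  Num.sqrt (complex.Re (ip I x x)).

Definition hconverges (R : realType) (H : lmodType R[i]) (I : inner_product H)
    (u : nat -> H) (l : H) : Prop :=
  forall eps : R, 0 < eps -> exists N : nat, forall n, (N <= n)%N -> hnorm I (u n - l) < eps.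

Definition hcauchy (R : realType) (H : lmodType R[i]) (I : inner_product H)
    (u : nat -> H) : Prop :=
  forall eps : R, 0 < eps -> exists N : nat,
    forall m n, (N <= m)%N -> (N <= n)%N -> hnorm I (u m - u n) < eps.

Record hilbert_space (R : realType) (H : lmodType R[i]) := HilbertSpace {
  hs_ip :> inner_product H;
  hs_complete : forall u : nat -> H, hcauchy hs_ip u -> exists l, hconverges hs_ip u l
}.

(* (Possibly unbounded) operators in H: a domain D(S) (a predicate on  *)
(* H) together with a map; the values of the map outside D(S) are      *)
(* irrelevant.  Linearity is a separate predicate [linear_op].          *)

Record op_in (R : realType) (H : lmodType R[i]) := OpIn {
  dom : H -> Prop;
  op : H -> H
}.

Definition linear_op (R : realType) (H : lmodType R[i]) (S : op_in H) : Prop :=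
  dom S 0 /\
  (forall (a : R[i]) x y, dom S x -> dom S y -> dom S (a *: x + y)) /\
  (forall (a : R[i]) x y, dom S x -> dom S y -> op S (a *: x + y) = a *: op S x + op S y).

Definition op_incl (R : realType) (H : lmodType R[i]) (S1 S2 : op_in H) : Prop :=
  (forall x, dom S1 x -> dom S2 x) /\ (forall x, dom S1 x -> op S2 x = op S1 x).

Definition op_eq (R : realType) (H : lmodType R[i]) (S1 S2 : op_in H) : Prop :=
  op_incl S1 S2 /\ op_incl S2 S1.

Definition op_comp (R : realType) (H : lmodType R[i]) (S T : op_in H) : op_in H :=
  @OpIn R H (fun x => dom T x /\ dom S (op T x)) (fun x => op S (op T x)).

Definition densely_defined (R : realType) (H : lmodType R[i]) (I : hilbert_space H)
    (S : op_in H) : Prop :=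
  forall (x : H) (eps : R), 0 < eps -> exists y, dom S y /\ hnorm I (x - y) < eps.

(* closed: the graph of S is closed in H x H (stated sequentially, which
   is equivalent since H x H is a metric space) *)
Definition closed_op (R : realType) (H : lmodType R[i]) (I : hilbert_space H)
    (S : op_in H) : Prop :=
  forall (u : nat -> H) (x y : H), (forall n, dom S (u n)) ->
    hconverges I u x -> hconverges I (fun n => op S (u n)) y ->
    dom S x /\ op S x = y.

(* Hilbert-space adjoint:
     D(S^* ) = {y | exists z, forall x in D(S), <Sx, y> = <x, z>},
     S^* y  = such a z (it is unique when S is densely defined). *)
Definition adj_rel (R : realType) (H : lmodType R[i]) (I : hilbert_space H)
    (S : op_in H) (y z : H) : Prop :=
  forall x, dom S x -> ip I (op S x) y = ip I x z.

Definition adjoint (R : realType) (H : lmodType R[i]) (I : hilbert_space H)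
    (S : op_in H) : op_in H :=
  @OpIn R H (fun y => exists z, adj_rel I S y z)
            (fun y => epsilon (inhabits (0 : H)) (adj_rel I S y)).

Definition normal_op (R : realType) (H : lmodType R[i]) (I : hilbert_space H)
    (N : op_in H) : Prop :=
  [/\ linear_op N, densely_defined I N, closed_op I N &
      op_eq (op_comp N (adjoint I N)) (op_comp (adjoint I N) N)].

(* Main.v *)
Require Import Defs.
From HB Require Import structures.
From mathcomp Require Import all_boot all_order all_algebra.
From mathcomp Require Import reals complex.
From mathcomp Require Import boolp classical_sets zify ring lra.
From Stdlib Require Import ClassicalEpsilon.

Set Implicit Arguments.
Unset Strict Implicit.
Unset Printing Implicit Defensive.
Import Order.TTheory GRing.Theory Num.Theory.
Local Open Scope ring_scope.

(* No spectral theorem is used.  For a normal N and r > 0 let H_r(N) be the space of all x in the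
   domain of every N^k with |N^k x| <= C r^k; since |N^k x|^2 <= |N^(k-1) x| |N^(k+1) x|, it is the
   largest N-invariant space on which N is bounded by r.  On its orthogonal complement N^* N is
   onto and bounded below by r^2; this comes from the absolute value of 2 r^2 (r^2 + N^* N)^-1 - 1,
   and implies that the union of the H_r(N) is dense.

   By the closed graph theorem T (1 + N^* N)^-1 is bounded, so the growth condition gives
   T H_r(N) <= H_r(M), and between these spaces Fuglede's theorem is needed only for bounded
   operators.  There the function z |-> <T (1 - z N^*/n)^n x, (1 + z^* M/n)^n y> is a polynomial
   whose linear coefficient is d = <T x, M y> - <T N^* x, y>, and on the circle |z| = rho it is
   bounded independently of n and rho as soon as n is large; hence |d| rho is bounded and d = 0.

   Finally, if x in D(T) is orthogonal to H_r(N) then T x is orthogonal to H_s(M) for s < r: solve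
   N^2 w = x, so that T x = M^2 T w, and iterate.  Therefore the component of T x in H_s(M) only
   depends on the component of x in H_2s(N), where Fuglede's theorem applies, and the theorem
   follows as s tends to infinity because M^* is closed. *)

(** * Real inner product spaces *)

(** Growth of iterates controls T on H_r(N) but says nothing about its orthogonal complement, and
    passing to adjoints does not help: the inclusion yields T^* M^* <= (T N)^*, where (T N)^* may be
    larger than N^* T^*. Hence the detour through N^2 w = x. The square appears because T is bounded
    relative to 1 + N^* N, and |N^* N w| = |N^2 w| keeps both |w| and |N^* N w| under control after
    each inversion. Each round gains (s / r)^2, so s < r must be strict; 2 s is a convenient choice
    of r.

    In the bounded case finite products replace the exponentials of the classical argument, which
    reduces Liouville's theorem to an estimate for one coefficient of a polynomial. The price is
    that the products are isometric only up to an error of second order, harmless once n is large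
    compared with (rho r)^2. *)

Lemma discriminant_le0 (R : realFieldType) (a b c : R) :
  0 <= a -> (forall t, 0 <= a * t ^+ 2 + 2 * b * t + c) -> b ^+ 2 <= a * c.
Proof.
rewrite le_eqVlt => /orP[/eqP <- | a_gt0] h; last first.
  have -> : b = a * (b / a) by field; lra.
  have := h (- (b / a)); set q := b / a => h1.
  have := mulr_ge0 (ltW a_gt0) h1.
  have -> : b = a * q by rewrite /q; field; lra.
  lra.
have [-> | b0] := eqVneq b 0; first by lra.
(* When the leading coefficient is 0, the polynomial takes the value -1 at this point. *)
have h1 := h (- ((c + 1) / (2 * b))).
have h2 : b * ((c + 1) / (2 * b)) = (c + 1) / 2 by field.
by lra.
Qed.

Section RealSequences.
Variable R : realType.

Definition rcvg (a : nat -> R) (l : R) : Prop :=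
  forall eps, 0 < eps -> exists N : nat, forall n, (N <= n)%N -> `|a n - l| < eps.

Lemma rcvg_cst c : rcvg (fun=> c) c.
Proof. by move=> e e0; exists 0%N => n _; rewrite subrr normr0. Qed.

Lemma rcvgD a b l m : rcvg a l -> rcvg b m -> rcvg (fun n => a n + b n) (l + m).
Proof.
move=> al bm e e0; have e2 : 0 < e / 2 by lra.
have [N hN] := al _ e2; have [M hM] := bm _ e2.
exists (maxn N M) => n; rewrite geq_max => /andP[/hN h1 /hM h2].
have -> : a n + b n - (l + m) = (a n - l) + (b n - m) by lra.
by apply: le_lt_trans (ler_normD _ _) _; lra.
Qed.

Lemma rcvgZ c a l : rcvg a l -> rcvg (fun n => c * a n) (c * l).
Proof.
move=> al e e0; have c1 : 0 < `|c| + 1 by rewrite ltr_wpDl.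
have [|N hN] := al (e / (`|c| + 1)); first by rewrite divr_gt0.
exists N => n /hN; rewrite ltr_pdivlMr // -mulrBr normrM => h.
apply: le_lt_trans h; rewrite mulrC ler_wpM2l //; lra.
Qed.

Lemma rcvg_le a b l m : rcvg a l -> rcvg b m -> (forall n, a n <= b n) -> l <= m.
Proof.
move=> al bm h; apply/ler_addgt0Pr => e e0; have e2 : 0 < e / 2 by lra.
have [N hN] := al _ e2; have [M hM] := bm _ e2.
have := hN _ (leq_maxl N M); have := hM _ (leq_maxr N M); have := h (maxn N M).
rewrite !ltr_norml => ? /andP[? ?] /andP[? ?]; lra.
Qed.

Lemma rcvg_uniq a l m : rcvg a l -> rcvg a m -> l = m.
Proof.
by move=> al am; apply/eqP; rewrite eq_le (rcvg_le al am) ?(rcvg_le am al).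
Qed.

Lemma rcvg_harmonic c : rcvg (fun n => c * n.+1%:R^-1) 0.
Proof.
rewrite -(mulr0 c); apply: rcvgZ => e e0; exists (Num.truncn e^-1) => n hn.
rewrite subr0 ger0_norm ?invr_ge0 ?ler0n //.
rewrite -[e]invrK ltf_pV2 ?posrE ?invr_gt0 ?ltr0n //.
apply: lt_le_trans (truncnS_gt _) _; by rewrite ler_nat ltnS.
Qed.

End RealSequences.

Record rinner (R : realType) (E : lmodType R) := RInner {
  dot : E -> E -> R;
  dotDl : forall x y z, dot (x + y) z = dot x z + dot y z;
  dotZl : forall a x z, dot (a *: x) z = a * dot x z;
  dotC : forall x y, dot x y = dot y x;
  dot_ge0 : forall x, 0 <= dot x x;
  dot_eq0 : forall x, dot x x = 0 -> x = 0
}.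

Section InnerProduct.
Variables (R : realType) (E : lmodType R) (B : rinner E).
Local Notation "<< x , y >>" := (dot B x y).

Lemma dotDr x y z : <<z, x + y>> = <<z, x>> + <<z, y>>.
Proof. by rewrite dotC dotDl !(dotC _ z). Qed.

Lemma dotZr a x z : <<z, a *: x>> = a * <<z, x>>.
Proof. by rewrite dotC dotZl (dotC _ z). Qed.

Lemma dotNl x z : <<- x, z>> = - <<x, z>>.
Proof. by rewrite -scaleN1r dotZl mulN1r. Qed.

Lemma dotNr x z : <<z, - x>> = - <<z, x>>.
Proof. by rewrite dotC dotNl dotC. Qed.

Lemma dot0l z : <<0, z>> = 0.
Proof. by rewrite -(scale0r 0) dotZl mul0r. Qed.

Lemma dot0r z : <<z, 0>> = 0.
Proof. by rewrite dotC dot0l. Qed.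

Definition dotE := (dotDl, dotDr, dotNl, dotNr, dotZl, dotZr, dot0l, dot0r).

Definition nrm x := Num.sqrt <<x, x>>.

Lemma nrm_ge0 x : 0 <= nrm x. Proof. exact: sqrtr_ge0. Qed.

Lemma sqr_nrm x : nrm x ^+ 2 = <<x, x>>.
Proof. by rewrite sqr_sqrtr // dot_ge0. Qed.

Lemma nrm0 : nrm 0 = 0. Proof. by rewrite /nrm dot0l sqrtr0. Qed.

Lemma nrm_eq0 x : nrm x = 0 -> x = 0.
Proof. by move=> h; apply: (@dot_eq0 _ _ B); rewrite -sqr_nrm h expr0n. Qed.

Lemma nrmZ a x : nrm (a *: x) = `|a| * nrm x.
Proof. by rewrite /nrm dotZl dotZr mulrA -expr2 sqrtrM ?sqr_ge0 // sqrtr_sqr. Qed.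

Lemma nrmN x : nrm (- x) = nrm x.
Proof. by rewrite -scaleN1r nrmZ normrN normr1 mul1r. Qed.

Lemma nrmB x y : nrm (x - y) = nrm (y - x).
Proof. by rewrite -nrmN opprB. Qed.

Lemma sqr_dot_le x y : <<x, y>> ^+ 2 <= <<x, x>> * <<y, y>>.
Proof.
rewrite mulrC; apply: discriminant_le0 => [|t]; first exact: dot_ge0.
have := dot_ge0 B (x + t *: y); rewrite !dotE (dotC B y x); lra.
Qed.

Lemma normr_dot_le x y : `|<<x, y>>| <= nrm x * nrm y.
Proof.
rewrite -(@ler_pXn2r _ 2) ?nnegrE ?mulr_ge0 ?nrm_ge0 //.
by rewrite exprMn !sqr_nrm real_normK ?num_real // sqr_dot_le.
Qed.

Lemma dot_le x y : <<x, y>> <= nrm x * nrm y.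
Proof. exact: le_trans (ler_norm _) (normr_dot_le x y). Qed.

Lemma nrmD x y : nrm (x + y) <= nrm x + nrm y.
Proof.
rewrite -(@ler_pXn2r _ 2) ?nnegrE ?addr_ge0 ?nrm_ge0 //.
rewrite sqr_nrm !dotE (dotC B y x) sqrrD !sqr_nrm.
have := dot_le x y; lra.
Qed.

Lemma nrm_le_dot x y c : 0 <= c -> <<x, x>> <= c ^+ 2 * <<y, y>> -> nrm x <= c * nrm y.
Proof.
move=> c0 h; rewrite -(@ler_pXn2r _ 2) ?nnegrE ?mulr_ge0 ?nrm_ge0 //.
by rewrite exprMn !sqr_nrm.
Qed.

Lemma dot_le_nrm x y c : 0 <= c -> nrm x <= c * nrm y -> <<x, x>> <= c ^+ 2 * <<y, y>>.
Proof.
move=> c0; rewrite -(@ler_pXn2r _ 2) ?nnegrE ?mulr_ge0 ?nrm_ge0 //.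
by rewrite exprMn !sqr_nrm.
Qed.

Lemma nrm_triangle x y z : nrm (x - z) <= nrm (x - y) + nrm (y - z).
Proof. by have := nrmD (x - y) (y - z); rewrite addrA subrK. Qed.

Lemma dot_nondegenerate x : (forall y, <<x, y>> = 0) -> x = 0.
Proof. by move=> h; apply: (@dot_eq0 _ _ B). Qed.

Definition scvg (u : nat -> E) (l : E) : Prop :=
  forall eps, 0 < eps -> exists N : nat, forall n, (N <= n)%N -> nrm (u n - l) < eps.

Definition scauchy (u : nat -> E) : Prop :=
  forall eps, 0 < eps -> exists N : nat,
    forall m n, (N <= m)%N -> (N <= n)%N -> nrm (u m - u n) < eps.

Definition scomplete := forall u, scauchy u -> exists l, scvg u l.

Lemma scvg_cst x : scvg (fun=> x) x.
Proof. by move=> e e0; exists 0%N => n _; rewrite subrr nrm0. Qed.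

Lemma scvg_dominated C u v l m : 0 <= C ->
  (forall n, nrm (v n - m) <= C * nrm (u n - l)) -> scvg u l -> scvg v m.
Proof.
move=> C0 h ul e e0; have C1 : 0 < C + 1 by lra.
have [|N hN] := ul (e / (C + 1)); first by rewrite divr_gt0.
exists N => n /hN; rewrite ltr_pdivlMr // => h2.
apply: le_lt_trans (h n) _; apply: le_lt_trans h2.
by rewrite mulrC ler_wpM2l ?nrm_ge0 //; lra.
Qed.

Lemma scvgD u v l m : scvg u l -> scvg v m -> scvg (fun n => u n + v n) (l + m).
Proof.
move=> ul vm e e0; have e2 : 0 < e / 2 by lra.
have [N hN] := ul _ e2; have [M hM] := vm _ e2.
exists (maxn N M) => n; rewrite geq_max => /andP[/hN h1 /hM h2].
have -> : u n + v n - (l + m) = (u n - l) + (v n - m) by rewrite opprD addrACA.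
by apply: le_lt_trans (nrmD _ _) _; lra.
Qed.

Lemma scvgZ a u l : scvg u l -> scvg (fun n => a *: u n) (a *: l).
Proof.
apply: (@scvg_dominated `|a|) => // n; by rewrite -scalerBr nrmZ.
Qed.

Lemma scvgN u l : scvg u l -> scvg (fun n => - u n) (- l).
Proof.
apply: (@scvg_dominated 1) => // n; by rewrite -opprD nrmN mul1r.
Qed.

Lemma scvgB u v l m : scvg u l -> scvg v m -> scvg (fun n => u n - v n) (l - m).
Proof. by move=> ul /scvgN; apply: scvgD. Qed.

Lemma scvg_shift u l : scvg u l -> scvg (fun n => u n.+1) l.
Proof. by move=> ul e /ul[N hN]; exists N => n h; apply: hN; apply: leqW. Qed.

Lemma scvg_cauchy u l : scvg u l -> scauchy u.
Proof.
move=> ul e e0; have e2 : 0 < e / 2 by lra.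
have [N hN] := ul _ e2; exists N => m n /hN h1 /hN h2.
apply: le_lt_trans (nrm_triangle _ l _) _.
by rewrite (nrmB l); lra.
Qed.

Lemma scauchy_dominated C u v : 0 <= C ->
  (forall m n, nrm (v m - v n) <= C * nrm (u m - u n)) -> scauchy u -> scauchy v.
Proof.
move=> C0 h cu e e0; have C1 : 0 < C + 1 by lra.
have [|N hN] := cu (e / (C + 1)); first by rewrite divr_gt0.
exists N => m n h1 h2; have := hN m n h1 h2; rewrite ltr_pdivlMr // => h3.
apply: le_lt_trans (h m n) _; apply: le_lt_trans h3.
by rewrite mulrC ler_wpM2l ?nrm_ge0 //; lra.
Qed.

Lemma scvg_uniq u l m : scvg u l -> scvg u m -> l = m.
Proof.
move=> ul um; apply/eqP; rewrite -subr_eq0; apply/eqP/nrm_eq0.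
apply/eqP; rewrite eq_le nrm_ge0 andbT; apply/ler_addgt0Pr => e e0; rewrite add0r.
have e2 : 0 < e / 2 by lra.
have [N hN] := ul _ e2; have [M hM] := um _ e2.
apply/ltW/(le_lt_trans (nrm_triangle l (u (maxn N M)) m)).
have := hN _ (leq_maxl N M); have := hM _ (leq_maxr N M).
by rewrite (nrmB l); lra.
Qed.

Lemma scvg_dot u v l m : scvg u l -> scvg v m -> rcvg (fun n => <<u n, v n>>) <<l, m>>.
Proof.
move=> ul vm e e0.
pose d := Num.min 1 (e / (2 * (2 + nrm l + nrm m))).
have nl := nrm_ge0 l; have nm := nrm_ge0 m.
have D0 : 0 < 2 * (2 + nrm l + nrm m) by lra.
have d0 : 0 < d by rewrite /d lt_min ltr01 divr_gt0.
have d1 : d <= 1 by rewrite /d ge_min lexx.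
have d2 : d * (2 * (2 + nrm l + nrm m)) <= e.
  by rewrite -ler_pdivlMr // /d ge_min lexx orbT.
have [N1 h1] := ul _ d0; have [N2 h2] := vm _ d0.
exists (maxn N1 N2) => n; rewrite geq_max => /andP[/h1 {}h1 /h2 {}h2].
have -> : <<u n, v n>> - <<l, m>> = <<u n - l, v n - m>> + <<l, v n - m>> + <<u n - l, m>>.
  by rewrite !dotE; lra.
have k1 := normr_dot_le (u n - l) (v n - m).
have k2 := normr_dot_le l (v n - m).
have k3 := normr_dot_le (u n - l) m.
have j1 : nrm (u n - l) * nrm (v n - m) <= d * 1.
  by apply: ler_pM; rewrite ?nrm_ge0 //; lra.
have j2 : nrm l * nrm (v n - m) <= nrm l * d by rewrite ler_wpM2l // ltW.
have j3 : nrm (u n - l) * nrm m <= d * nrm m by rewrite ler_wpM2r // ltW.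
have := ler_normD (<<u n - l, v n - m>> + <<l, v n - m>>) <<u n - l, m>>.
have := ler_normD <<u n - l, v n - m>> <<l, v n - m>>.
lra.
Qed.

Lemma scvg_dot_eq u v l m c : scvg u l -> scvg v m ->
  (forall n, <<u n, v n>> = c) -> <<l, m>> = c.
Proof.
move=> ul vm h; have := scvg_dot ul vm; under eq_fun do rewrite h.
by move=> /rcvg_uniq; apply; apply: rcvg_cst.
Qed.

Lemma scvg_nrm_le u l c : 0 <= c -> scvg u l -> (forall n, nrm (u n) <= c) -> nrm l <= c.
Proof.
move=> c0 ul h; rewrite -(@ler_pXn2r _ 2) ?nnegrE ?nrm_ge0 // sqr_nrm.
apply: (rcvg_le (scvg_dot ul ul) (rcvg_cst _)) => n.
by rewrite -sqr_nrm ler_pXn2r ?nnegrE ?nrm_ge0.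
Qed.

Lemma scvg_squeeze u l a : rcvg a 0 -> (forall n, nrm (u n - l) <= a n) -> scvg u l.
Proof.
move=> a0 h e /a0[N hN]; exists N => n /hN; rewrite subr0 => h1.
by apply: le_lt_trans (h n) _; apply: le_lt_trans (ler_norm _) h1.
Qed.

End InnerProduct.

(** * Graphs of closed operators *)

Lemma exists_choice (X Y : Type) (P : X -> Y -> Prop) :
  (forall x, exists y, P x y) -> exists f, forall x, P x (f x).
Proof. by move=> /choice[f hf]; exists f. Qed.

Section LinearOperators.
Variables (R : realType) (E : lmodType R) (B : rinner E).
Local Notation "<< x , y >>" := (dot B x y).
Local Notation nrm := (nrm B).
Local Notation scvg := (scvg B).

Definition subsp (V : E -> Prop) : Prop :=
  V 0 /\ forall a x y, V x -> V y -> V (a *: x + y).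

Definition linear_on (D : E -> Prop) (L : E -> E) : Prop :=
  forall a x y, D x -> D y -> L (a *: x + y) = a *: L x + L y.

Definition closed_on (D : E -> Prop) (L : E -> E) : Prop :=
  forall u x y, (forall n, D (u n)) -> scvg u x -> scvg (fun n => L (u n)) y -> D x /\ L x = y.

Definition sclosed (V : E -> Prop) : Prop :=
  forall u x, (forall n, V (u n)) -> scvg u x -> V x.

Section Subspace.
Variables (V : E -> Prop) (sV : subsp V).

Lemma subsp0 : V 0. Proof. by case: sV. Qed.

Lemma subspZ a x : V x -> V (a *: x).
Proof. by move=> h; rewrite -[a *: x]addr0; case: sV => h0; apply. Qed.

Lemma subspD x y : V x -> V y -> V (x + y).
Proof. by move=> hx hy; rewrite -[x]scale1r; case: sV => _; apply. Qed.

Lemma subspN x : V x -> V (- x).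
Proof. by rewrite -scaleN1r; apply: subspZ. Qed.

Lemma subspB x y : V x -> V y -> V (x - y).
Proof. by move=> hx hy; apply: subspD => //; apply: subspN. Qed.

Variables (L : E -> E) (lL : linear_on V L).

Lemma linear_onD x y : V x -> V y -> L (x + y) = L x + L y.
Proof. by move=> hx hy; have := lL 1 hx hy; rewrite !scale1r. Qed.

Lemma linear_on0 : L 0 = 0.
Proof.
have := linear_onD subsp0 subsp0; rewrite addr0 => h.
by apply: (addrI (L 0)); rewrite addr0 -h.
Qed.

Lemma linear_onZ a x : V x -> L (a *: x) = a *: L x.
Proof. by move=> hx; have := lL a hx subsp0; rewrite linear_on0 !addr0. Qed.

Lemma linear_onN x : V x -> L (- x) = - L x.
Proof. by move=> hx; rewrite -!scaleN1r linear_onZ. Qed.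

Lemma linear_onB x y : V x -> V y -> L (x - y) = L x - L y.
Proof. by move=> hx hy; rewrite linear_onD ?linear_onN //; apply: subspN. Qed.

End Subspace.

Hypothesis complE : scomplete B.

(* [x] minimizes [a |z - v|^2 + |y - L v|^2] over the domain: [(x, L x)] is the projection of
   [(z, y)] onto the graph of [L], for the inner product weighted by [a]. *)
Lemma graph_projection D L (a : R) z y : subsp D -> linear_on D L -> closed_on D L -> 0 < a ->
  exists x, D x /\ forall h, D h -> a * <<z - x, h>> = <<L x - y, L h>>.
Proof.
move=> sD lL cL a0.
pose q v := a * <<z - v, z - v>> + <<y - L v, y - L v>>.
have q0 v : 0 <= q v by rewrite addr_ge0 ?dot_ge0 // mulr_ge0 ?dot_ge0 // ltW.
pose S := (fun r => exists2 v, D v & r = q v) : set R.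
have lbS : lbound S 0 by move=> _ [v _ ->].
have infS : has_inf S by split; [exists (q 0); exists 0 => //; apply: subsp0 | exists 0].
pose d := inf S.
have dq v : D v -> d <= q v by move=> hv; apply: ge_inf; [exists 0 | exists v].
have [v vP] : exists v, forall n, D (v n) /\ q (v n) < d + n.+1%:R^-1.
  apply: (@exists_choice _ _ (fun n v => D v /\ q v < d + n.+1%:R^-1)) => n.
  have [|_ [v Dv ->] h] := @inf_adherent _ S n.+1%:R^-1 _ infS.
    by rewrite invr_gt0 ltr0n.
  by exists v.
have Dv n : D (v n) := (vP n).1.
(* [q (v n + t *: h) - d] is a nonnegative quadratic polynomial in [t]; its discriminant bounds the
   first variation at [v n] by the defect [q (v n) - d]. *)
have key n h : D h -> (a * <<z - v n, h>> - <<L (v n) - y, L h>>) ^+ 2 <=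
    (a * <<h, h>> + <<L h, L h>>) * (q (v n) - d).
  move=> Dh; rewrite -sqrrN opprB; apply: discriminant_le0 => [|t].
    by rewrite addr_ge0 ?dot_ge0 // mulr_ge0 ?dot_ge0 // ltW.
  have := dq (v n + t *: h) (subspD sD (Dv n) (subspZ sD t Dh)).
  rewrite /q (linear_onD lL) ?(linear_onZ sD lL) //; last exact: subspZ.
  rewrite !dotE (dotC B h z) (dotC B h (v n)) (dotC B z (v n)).
  rewrite (dotC B (L h) (L (v n))) (dotC B (L h) y); lra.
(* Parallelogram identity, with [q] at the midpoint bounded below by [d]. *)
have cau m n : a * <<v m - v n, v m - v n>> + <<L (v m) - L (v n), L (v m) - L (v n)>>
    <= 2 * (q (v m) - d) + 2 * (q (v n) - d).
  have := dq (2^-1 *: (v m + v n)) (subspZ sD _ (subspD sD (Dv m) (Dv n))).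
  rewrite /q (linear_onZ sD lL) ?(linear_onD lL) //; last exact: subspD.
  rewrite !dotE (dotC B (v n) z) (dotC B (v n) (v m)) (dotC B (v m) z) (dotC B (L (v n)) (L (v m))).
  lra.
have small e : 0 < e -> exists N : nat, forall m n, (N <= m)%N -> (N <= n)%N ->
    a * <<v m - v n, v m - v n>> + <<L (v m) - L (v n), L (v m) - L (v n)>> < e.
  move=> e0; have [|N hN] := @rcvg_harmonic R 4 e => //; exists N => m n hm hn.
  apply: le_lt_trans (cau m n) _.
  have := hN _ hm; have := hN _ hn; rewrite !subr0 !ger0_norm ?mulr_ge0 ?invr_ge0 ?ler0n //.
  have := (vP m).2; have := (vP n).2; move: n.+1%:R^-1 m.+1%:R^-1 => i j; lra.
have [x vx] : exists x, scvg v x.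
  apply: complE => e e0; have [|N hN] := small (a * e ^+ 2); first by rewrite mulr_gt0 ?exprn_gt0.
  exists N => m n hm hn; rewrite -(@ltr_pXn2r _ 2) ?nnegrE ?nrm_ge0 ?(ltW e0) // sqr_nrm.
  rewrite -(ltr_pM2l a0); apply: le_lt_trans (hN _ _ hm hn).
  by rewrite lerDl dot_ge0.
have [y' vy] : exists y', scvg (fun n => L (v n)) y'.
  apply: complE => e e0; have [|N hN] := small (e ^+ 2); first by rewrite exprn_gt0.
  exists N => m n hm hn; rewrite -(@ltr_pXn2r _ 2) ?nnegrE ?nrm_ge0 ?(ltW e0) // sqr_nrm.
  by apply: le_lt_trans (hN _ _ hm hn); rewrite lerDr mulr_ge0 ?dot_ge0 // ltW.
have [Dx Lx] := cL _ _ _ Dv vx vy; exists x; split=> // h Dh.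
pose F := a * <<z - x, h>> - <<L x - y, L h>>.
suff F0 : F = 0 by move: F0; rewrite /F; lra.
have Fl : rcvg (fun n => a * <<z - v n, h>> - <<L (v n) - y, L h>>) F.
  rewrite /F Lx -mulN1r; apply: rcvgD.
    apply: rcvgZ; apply: scvg_dot; last exact: scvg_cst.
    exact: (scvgB (scvg_cst _ z) vx).
  under eq_fun do rewrite -mulN1r.
  apply: rcvgZ; apply: scvg_dot; last exact: scvg_cst.
  exact: (scvgB vy (scvg_cst _ y)).
apply: (@rcvg_uniq _ _ _ _ Fl) => e e0.
have [|N hN] := @rcvg_harmonic R (a * <<h, h>> + <<L h, L h>>) (e ^+ 2).
  by rewrite exprn_gt0.
exists N => n /hN; rewrite !subr0 => h1.
rewrite -(@ltr_pXn2r _ 2) ?nnegrE ?(ltW e0) // real_normK ?num_real //.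
apply: le_lt_trans (key n h Dh) _; apply: le_lt_trans h1.
apply: le_trans (ler_norm _); rewrite ler_wpM2l //.
  by rewrite addr_ge0 ?dot_ge0 // mulr_ge0 ?dot_ge0 // ltW.
by have := (vP n).2; move: n.+1%:R^-1 => i; lra.
Qed.

(* In operator terms [x = a (a + L^* L)^-1 z]. *)
Lemma graph_resolvent D L (a : R) z : subsp D -> linear_on D L -> closed_on D L -> 0 < a ->
  exists x, D x /\ forall h, D h -> a * <<z - x, h>> = <<L x, L h>>.
Proof.
by move=> sD lL cL a0; have := graph_projection z 0 sD lL cL a0; under eq_fun do rewrite subr0.
Qed.

(** The zero operator on [V] is closed because [V] is, and projecting onto its graph is projecting
    onto [V]. *)
Lemma orthogonal_projection V x : subsp V -> sclosed V ->
  exists p, V p /\ forall v, V v -> <<x - p, v>> = 0.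
Proof.
move=> sV cV; have lL : linear_on V (fun=> 0) by move=> *; rewrite scaler0 addr0.
have cL : closed_on V (fun=> 0).
  by move=> u y w hu uy /scvg_uniq h; split; [apply: cV hu uy | apply/esym/h; apply: scvg_cst].
have [p [Vp hp]] := graph_resolvent x sV lL cL ltr01.
by exists p; split=> // v /hp; rewrite mul1r dot0l.
Qed.

(** The lower bound makes the range closed. By symmetry, a vector of [V] orthogonal to the range is
    in the kernel of [L], which the lower bound makes trivial. *)
Lemma coercive_onto V L c : subsp V -> sclosed V -> linear_on V L ->
  (forall v, V v -> V (L v)) -> (forall u v, V u -> V v -> <<L u, v>> = <<u, L v>>) ->
  0 < c -> (forall v, V v -> c * nrm v <= nrm (L v)) ->
  forall y, V y -> exists v, V v /\ L v = y.
Proof.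
move=> sV cV lL VL sL c0 hc y Vy.
pose W w := exists v, V v /\ L v = w.
have sW : subsp W.
  split=> [|a _ _ [v [Vv <-]] [w [Vw <-]]].
    by exists 0; split; [apply: subsp0 | apply: linear_on0 lL].
  by exists (a *: v + w); split; [apply: sV.2 | apply: lL].
have cW : sclosed W.
  move=> u x hu ux; have {hu}[v hv] := exists_choice hu.
  have [l vl] : exists l, scvg v l.
    apply: complE; apply: (@scauchy_dominated _ _ B c^-1 u).
    - by rewrite invr_ge0 ltW.
    - move=> m n; rewrite mulrC ler_pdivlMr // mulrC.
      rewrite -(hv m).2 -(hv n).2 -(linear_onB sV lL) ?(hv m).1 ?(hv n).1 //.
      + by apply: hc; apply: subspB => //; [apply: (hv m).1 | apply: (hv n).1].
      + exact: (hv m).1.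
      + exact: (hv n).1.
    - exact: scvg_cauchy ux.
  have Vl : V l by apply: cV vl => n; apply: (hv n).1.
  exists l; split=> //; apply/eqP; rewrite -subr_eq0; apply/eqP.
  have Vx : V x.
    by apply: (cV _ _ _ ux) => n; rewrite -(hv n).2; apply/VL/(hv n).1.
  have Vd : V (L l - x) by apply: subspB => //; apply: VL.
  apply: (@dot_eq0 _ _ B); rewrite dotDl dotNl sL //.
  apply/eqP; rewrite subr_eq0; apply/eqP.
  apply: (@rcvg_uniq _ (fun n => <<u n, L l - x>>)).
    have -> : (fun n => <<u n, L l - x>>) = fun n => <<v n, L (L l - x)>>.
      by apply/funext => n; rewrite -(hv n).2 sL ?(hv n).1 //; apply: (hv n).1.
    by apply: scvg_dot => //; apply: scvg_cst.
  by apply: scvg_dot => //; apply: scvg_cst.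
have [p [Wp hp]] := orthogonal_projection y sW cW.
have Vp : V p by case: Wp => v [Vv <-]; apply: VL.
have Vr : V (y - p) by apply: subspB.
have : <<L (y - p), L (y - p)>> = 0.
  rewrite sL //; last exact: VL.
  by apply: hp; exists (L (y - p)); split=> //; apply: VL.
move=> /dot_eq0 h; have := hc _ Vr; rewrite h nrm0 pmulr_rle0 // => h2.
have : y - p = 0 by apply: (@nrm_eq0 _ _ B); apply/eqP; rewrite eq_le h2 nrm_ge0.
by move/eqP; rewrite subr_eq0 => /eqP ->.
Qed.
End LinearOperators.

(** * Uniform boundedness and the closed graph theorem *)

Lemma rcvg_geometric (R : realType) (q c : R) :
  0 <= q -> q < 1 -> rcvg (fun n => c * q ^+ n) 0.
Proof.
move=> q0 q1; rewrite -(mulr0 c); apply: rcvgZ.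
(* Each of the [n.+1] terms of 1 + q + ... + q^n is at least q^n; so q^n is O(1 / n), which is
   enough for convergence to 0. *)
have key n : (1 - q) * n.+1%:R * q ^+ n <= 1 - q ^+ n.+1.
  elim: n => [|n IH]; first by rewrite expr0 expr1 !mulr1; lra.
  have h : 0 <= (1 - q) * (1 - q ^+ n.+1).
    by rewrite mulr_ge0 ?subr_ge0 ?exprn_ile1 // ltW.
  have := ler_wpM2l q0 IH; move: h; rewrite -[n.+2%:R]natr1 !exprS.
  by move: (q ^+ n) (n.+1%:R) => p m; lra.
move=> e e0; have [|N hN] := @rcvg_harmonic R (1 - q)^-1 e => //; exists N => n /hN.
rewrite !subr0 (ger0_norm (exprn_ge0 _ q0)) => h; apply: le_lt_trans h.
apply: le_trans (ler_norm _).
rewrite ler_pdivlMr ?ltr0n // -[leRHS]mul1r ler_pdivlMr ?subr_gt0 //.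
have := key n; have : 0 <= q ^+ n.+1 by rewrite exprn_ge0.
by move: (q ^+ n) (q ^+ n.+1) => p r; lra.
Qed.

Section UniformBoundedness.
Variables (R : realType) (E : lmodType R) (B : rinner E).
Hypothesis complE : scomplete B.
Local Notation "<< x , y >>" := (dot B x y).
Local Notation nrm := (nrm B).
Local Notation scvg := (scvg B).

(** A gliding hump in place of Baire's theorem: from a sequence of ever larger functionals one
    builds a convergent series of small moves whose sum is a point where they are unbounded. *)
Lemma uniform_boundedness (G : E -> Prop) :
  (forall h, exists c, forall g, G g -> `|<<g, h>>| <= c) ->
  exists C, 0 <= C /\ forall g, G g -> nrm g <= C.
Proof.
move=> ptw; apply: contrapT => unb.
have big C : exists g, G g /\ Num.max 0 C < nrm g.
  apply: contrapT => no; apply: unb; exists (Num.max 0 C); split=> [|g Gg].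
    by rewrite le_max lexx.
  by rewrite leNgt; apply/negP => h; apply: no; exists g.
(* With ratio 1/3 the moves after step [n] add up to at most [d n / 2]. They can therefore destroy
   only half of the value [d n * nrm g] reached at that step, which explains the factor 2 in
   [2 * a.1%:R] below. *)
pose d n : R := (3^-1) ^+ n.
have d0 n : 0 < d n by rewrite exprn_gt0 // invr_gt0.
have dS n : d n = 3 * d n.+1 by rewrite /d exprS; field.
(* One of [x + e], [x - e] moves the functional [<g, .>] by at least [<g, e>]. *)
have step (a : nat * E) : exists p : E * E,
    [/\ G p.1, nrm (p.2 - a.2) <= d a.1, d a.1 * nrm p.1 <= `|<<p.1, p.2>>|
      & 2 * a.1%:R <= d a.1 * nrm p.1].
  case: a => n x /=; have [g [Gg]] := big (2 * n%:R / d n).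
  rewrite gt_max => /andP[g0]; rewrite ltr_pdivrMr // => hn.
  pose e := (d n / nrm g) *: g.
  have ge : <<g, e>> = d n * nrm g.
    by rewrite dotZr -sqr_nrm; field; rewrite gt_eqF.
  have ne : nrm e = d n.
    by rewrite nrmZ ger0_norm ?divr_ge0 ?ltW // -mulrA mulVf ?mulr1 ?gt_eqF.
  have gd : 0 < d n * nrm g by rewrite mulr_gt0.
  have [h | h] := lerP 0 <<g, x>>.
    exists (g, x + e); split=> //=; rewrite ?[x + e]addrC ?addrK ?ne //.
      by rewrite dotDr ge ger0_norm; lra.
    by rewrite mulrC ltW // mulrC [d n * _]mulrC.
  exists (g, x - e); split=> //=; first by rewrite addrAC subrr add0r nrmN ne.
    by rewrite dotDr dotNr ge ler0_norm; lra.
  by rewrite mulrC ltW // mulrC [d n * _]mulrC.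
have {step}[f fP] := exists_choice step.
pose X := fix X n := if n is m.+1 then (f (m, X m)).2 else 0.
pose g n := (f (n, X n)).1.
have Xd n k : nrm (X (n + k)%N - X n) <= (3 / 2) * (d n - d (n + k)%N).
  elim: k => [|k IH]; first by rewrite addn0 !subrr nrm0 mulr0.
  apply: le_trans (nrm_triangle B _ (X (n + k)%N) _) _.
  have [_ /= h _ _] := fP ((n + k)%N, X (n + k)%N).
  rewrite addnS; have := dS (n + k)%N; move: h IH => /=; lra.
have Xc : scauchy B X.
  have t0 : 0 <= 3^-1 :> R by lra.
  have t1 : 3^-1 < 1 :> R by lra.
  move=> e e0; have [N hN] := rcvg_geometric (3 / 2) t0 t1 e0.
  have hX n k : (N <= n)%N -> nrm (X (n + k)%N - X n) < e.
    move=> /hN; rewrite subr0 => h; apply: le_lt_trans (Xd n k) _; apply: le_lt_trans h.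
    apply: le_trans (ler_norm _); rewrite ler_wpM2l ?divr_ge0 //.
    by rewrite gerBl ltW.
  exists N => m n hm hn; have [le|le] := leqP m n.
    by rewrite -(subnKC le) nrmB hX.
  by rewrite -(subnKC (ltnW le)) hX.
have [x Xx] := complE Xc.
have [c cP] := ptw x.
pose n := (Num.truncn c).+1.
have [/= Gg _ h1 h2] := fP (n, X n).
have cn : c < n%:R by rewrite truncnS_gt.
have hx : nrm (x - X n.+1) <= (3 / 2) * d n.+1.
  apply: (@scvg_nrm_le _ _ B (fun k => X (n.+1 + k)%N - X n.+1)).
  - by rewrite mulr_ge0 ?divr_ge0 // ltW.
  - apply: scvgB; last exact: scvg_cst.
    by move=> e /Xx[N hN]; exists N => k hk; apply: hN; apply: leq_trans hk (leq_addl _ _).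
  - by move=> k; apply: le_trans (Xd _ _) _; rewrite ler_wpM2l ?divr_ge0 // gerBl ltW.
have := cP _ Gg; rewrite -/(g n) in h1 h2 *.
have -> : <<g n, x>> = <<g n, X n.+1>> + <<g n, x - X n.+1>> by rewrite dotDr dotNr; lra.
have k1 := normr_dot_le B (g n) (x - X n.+1).
have k2 : nrm (g n) * nrm (x - X n.+1) <= nrm (g n) * (3 / 2 * d n.+1).
  by rewrite ler_wpM2l ?nrm_ge0.
have k3 := lerB_normD <<g n, X n.+1>> <<g n, x - X n.+1>>.
move: h1 h2; rewrite (dS n) -/(X n.+1); nra.
Qed.

Lemma subsp_setT : subsp (fun _ : E => True). Proof. by []. Qed.

Definition has_adjoint (D : E -> Prop) (L : E -> E) y :=
  exists w, forall h, D h -> <<w, h>> = <<y, L h>>.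

Lemma subsp_has_adjoint (D : E -> Prop) (L : E -> E) : linear_on D L ->
  subsp D -> subsp (fun u => D u /\ has_adjoint D L (L u)).
Proof.
move=> lL sD; split.
  split; first exact: subsp0; exists 0 => h Dh.
  by rewrite (linear_on0 sD lL) !dot0l.
move=> a x y [Dx [w hw]] [Dy [w' hw']]; split; first exact: sD.2.
by exists (a *: w + w') => h Dh; rewrite lL // !dotDl !dotZl hw // hw'.
Qed.

(** The hypothesis on [Z] says that only 0 in the graph of [L] is orthogonal to the graph over [Z].
    [D'] is the domain of the closure of [L] restricted to [Z]; subtracting from [(x, L x)] its
    projection onto that closed graph leaves such an orthogonal vector. *)
Lemma graph_core (D Z : E -> Prop) L x : subsp D -> linear_on D L -> closed_on B D L ->
  subsp Z -> (forall u, Z u -> D u) ->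
  (forall v, D v -> (forall u, Z u -> <<v, u>> + <<L v, L u>> = 0) -> v = 0) ->
  D x -> exists u, (forall n : nat, Z (u n)) /\ scvg u x /\ scvg (fun n => L (u n)) (L x).
Proof.
move=> sD lL cL sZ ZD hZ Dx.
pose D' y := D y /\ forall e, 0 < e -> exists u, Z u /\ nrm (u - y) < e /\ nrm (L u - L y) < e.
have sD' : subsp D'.
  split=> [|a y z [Dy hy] [Dz hz]].
    split=> [|e e0]; first exact: subsp0.
    by exists 0; split; [exact: subsp0 | rewrite !subrr nrm0].
  split=> [|e e0]; first exact: sD.2.
  have a1 : 0 < `|a| + 1 by rewrite ltr_wpDl.
  have [|u [Zu [u1 u2]]] := hy (e / 2 / (`|a| + 1)); first by rewrite !divr_gt0.
  have [|v [Zv [v1 v2]]] := hz (e / 2); first by rewrite !divr_gt0.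
  exists (a *: u + v); split; first exact: sZ.2.
  have sep (p q r s : E) : nrm (p - r) < e / 2 / (`|a| + 1) -> nrm (q - s) < e / 2 ->
      nrm (a *: p + q - (a *: r + s)) < e.
    rewrite ltr_pdivlMr // mulrDr mulr1 => h1 h2; rewrite opprD addrACA -scalerBr.
    apply: le_lt_trans (nrmD _ _ _) _; rewrite nrmZ.
    have := nrm_ge0 B (p - r); move: h1 h2; rewrite mulrC; lra.
  split; first exact: sep.
  by rewrite !lL //; [apply: sep | apply: ZD | apply: ZD].
have cL' : closed_on B D' L.
  move=> u y z hu uy Luz; have [Dy Ly] := cL _ _ _ (fun n => (hu n).1) uy Luz.
  split=> //; split=> // e e0; have e2 : 0 < e / 2 by lra.
  have [N hN] := uy _ e2; have [M hM] := Luz _ e2.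
  have {}hN := hN _ (leq_maxl N M); have {}hM := hM _ (leq_maxr N M).
  have [v [Zv [v1 v2]]] := (hu (maxn N M)).2 _ e2.
  exists v; split=> //; rewrite Ly.
  have := nrm_triangle B v (u (maxn N M)) y.
  have := nrm_triangle B (L v) (L (u (maxn N M))) z; lra.
have lL' : linear_on D' L by move=> a y z [Dy _] [Dz _]; apply: lL.
have [p [[Dp pP] hp]] := graph_projection complE x (L x) sD' lL' cL' ltr01.
have /eqP : x - p = 0.
  apply: hZ => [|u Zu]; first exact: subspB.
  have Du' : D' u by split=> [|e e0]; [apply: ZD | exists u; rewrite !subrr nrm0].
  have := hp _ Du'; rewrite (linear_onB sD lL) // mul1r => ->.
  by rewrite -dotDl -[L p - L x]opprB addNr dot0l.
rewrite subr_eq0 => /eqP E0; rewrite -E0 in pP.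
have [v vP] : exists v, forall n : nat,
    Z (v n) /\ nrm (v n - x) < n.+1%:R^-1 /\ nrm (L (v n) - L x) < n.+1%:R^-1.
  apply: (exists_choice (P := fun (n : nat) v => Z v /\ nrm (v - x) < n.+1%:R^-1 /\
    nrm (L v - L x) < n.+1%:R^-1)) => n; apply: pP.
  by rewrite invr_gt0 ltr0n.
exists v; split; first by move=> n; apply: (vP n).1.
have r0 := @rcvg_harmonic R 1.
split; [apply: (scvg_squeeze r0) => n | apply: (scvg_squeeze r0) => n].
  by rewrite mul1r ltW //; case: (vP n) => _ [].
by rewrite mul1r ltW //; case: (vP n) => _ [].
Qed.

(** Von Neumann's theorem that D(L^* L) is a core for L. If v is orthogonal to it in the graph inner
    product, testing against u = (1 + L^* L)^-1 v gives <v, v> = 0. *)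
Lemma adjoint_comp_core (D : E -> Prop) L x : subsp D -> linear_on D L -> closed_on B D L -> D x ->
  exists u, (forall n : nat, D (u n) /\ has_adjoint D L (L (u n))) /\
    scvg u x /\ scvg (fun n => L (u n)) (L x).
Proof.
move=> sD lL cL; apply: (graph_core sD lL cL (subsp_has_adjoint lL sD)) => [u [] //|v Dv hv].
have [u [Du hu]] := graph_resolvent complE v sD lL cL ltr01.
apply: (@dot_eq0 _ _ B).
have Zu : D u /\ has_adjoint D L (L u).
  by split=> //; exists (v - u) => h /hu; rewrite mul1r.
by have := hv u Zu; have := hu v Dv; rewrite mul1r dotDl dotNl (dotC B u) (dotC B (L u)); lra.
Qed.

(** [G] is the image of the unit ball under L^*; it is pointwise bounded since |<L^* v, h>| <= |L
    h|. Its uniform bound C gives |L x|^2 = <L^* L x, x> <= C |L x| |x| on D(L^* L), and this is a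
    core. *)
Lemma closed_graph L : linear_on (fun=> True) L -> closed_on B (fun=> True) L ->
  exists C, 0 <= C /\ forall x, nrm (L x) <= C * nrm x.
Proof.
move=> lL cL.
pose G w := exists v, nrm v <= 1 /\ forall h, <<w, h>> = <<v, L h>>.
have [h|C [C0 CP]] := @uniform_boundedness G.
  exists (nrm (L h)) => g [v [v1 gv]]; rewrite gv; apply: le_trans (normr_dot_le _ _ _) _.
  by rewrite ler_piMl ?nrm_ge0.
have key x : has_adjoint (fun=> True) L (L x) -> nrm (L x) <= C * nrm x.
  move=> [w hw]; have [->|n0] := eqVneq (nrm (L x)) 0; first by rewrite mulr_ge0 ?nrm_ge0.
  have n1 : 0 < nrm (L x) by rewrite lt_neqAle eq_sym n0 nrm_ge0.
  have : G ((nrm (L x))^-1 *: w).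
    exists ((nrm (L x))^-1 *: L x); split=> [|h]; last by rewrite !dotZl hw.
    by rewrite nrmZ ger0_norm ?mulVf // invr_ge0 nrm_ge0.
  move=> /CP; rewrite nrmZ ger0_norm ?invr_ge0 ?nrm_ge0 // mulrC ler_pdivrMr // => h1.
  rewrite -(ler_pM2r n1) -expr2 sqr_nrm -hw //.
  apply: le_trans (dot_le _ _ _) _; rewrite mulrAC.
  by rewrite ler_wpM2r ?nrm_ge0.
exists C; split=> // x.
have [u [uP [ux Lux]]] := adjoint_comp_core (x := x) subsp_setT lL cL I.
rewrite -(@ler_pXn2r _ 2) ?nnegrE ?mulr_ge0 ?nrm_ge0 // exprMn !sqr_nrm.
apply: (rcvg_le (scvg_dot Lux Lux) (rcvgZ (C ^+ 2) (scvg_dot ux ux))) => n.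
by apply: dot_le_nrm => //; apply: key; case: (uP n).
Qed.

End UniformBoundedness.
Arguments subsp_setT {R E}.

(** * The absolute value of a self-adjoint contraction *)

Lemma nondecreasing_bounded_cauchy (R : realType) (a : nat -> R) M :
  (forall m n, (m <= n)%N -> a m <= a n) -> (forall n, a n <= M) ->
  forall e, 0 < e -> exists N : nat, forall n, (N <= n)%N -> a n - a N < e.
Proof.
move=> mono bd e e0.
have hs : has_sup (range a) by split; [exists (a 0%N); exists 0%N | exists M => _ [n _ <-]].
have [_ [N _ <-] hN] := sup_adherent e0 hs; exists N => n _.
have := @ub_le_sup _ (range a) hs.2 (a n) (ex_intro2 _ _ n I erefl); lra.
Qed.

Section AbsoluteValue.
Variables (R : realType) (E : lmodType R) (B : rinner E).
Hypothesis complE : scomplete B.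
Local Notation "<< x , y >>" := (dot B x y).
Local Notation nrm := (nrm B).
Local Notation scvg := (scvg B).

Lemma bounded_closed_on L (c : R) : linear_on (fun=> True) L -> 0 <= c ->
  (forall x, nrm (L x) <= c * nrm x) -> closed_on B (fun=> True) L.
Proof.
move=> lL c0 hL u x y _ ux Luy; split=> //; apply: scvg_uniq Luy.
apply: (scvg_dominated c0 _ ux) => n.
by rewrite -(linear_onB subsp_setT lL).
Qed.

Variables (A : E -> E).
Hypothesis (lA : linear_on (fun=> True) A).
Hypothesis (sA : forall x y, <<A x, y>> = <<x, A y>>).
Hypothesis (nA : forall x, nrm (A x) <= nrm x).

Local Notation C := (fun x => x - A (A x)).

Let lC : linear_on (fun=> True) C.
Proof. by move=> a x y _ _; rewrite !lA // scalerBr opprD addrACA. Qed.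

Let sC x y : <<C x, y>> = <<x, C y>>.
Proof. by rewrite !dotE !sA. Qed.

Let C_ge0 x : 0 <= <<C x, x>>.
Proof.
rewrite dotDl dotNl sA subr_ge0 -!sqr_nrm.
by rewrite ler_pXn2r ?nnegrE ?nrm_ge0.
Qed.

Let nC x : nrm (C x) <= nrm x.
Proof.
rewrite -[leRHS]mul1r; apply: nrm_le_dot => //; rewrite expr1n mul1r.
have h : <<A (A x), A (A x)>> <= <<A x, A x>>.
  by rewrite -!sqr_nrm ler_pXn2r ?nnegrE ?nrm_ge0.
have := dot_ge0 B (A x); move: h; rewrite !dotE !(sA _ x) (dotC B x) !sA; lra.
Qed.

(* Polynomials in [C] with nonnegative coefficients.  The iterates below and their differences
   lie in this cone, which makes the iteration monotone. *)
Inductive cone : (E -> E) -> Prop :=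
| cone0 : cone (fun=> 0)
| cone_id : cone (fun x => x)
| coneC X : cone X -> cone (fun x => C (X x))
| coneD X Y : cone X -> cone Y -> cone (fun x => X x + Y x)
| coneZ a X : 0 <= a -> cone X -> cone (fun x => a *: X x).

Lemma cone_linear X : cone X -> linear_on (fun=> True) X.
Proof.
elim=> {X} [|| X _ IH | X Y _ IH1 _ IH2 | a X _ _ IH] b x y _ _.
- by rewrite scaler0 addr0.
- by [].
- by rewrite IH // lC.
- by rewrite IH1 // IH2 // scalerDr addrACA.
- by rewrite IH // scalerDr !scalerA mulrC.
Qed.

Lemma cone_commC X x : cone X -> X (C x) = C (X x).
Proof.
elim=> {X} [|| X _ IH | X Y _ IH1 _ IH2 | a X _ _ IH] //=.
- by rewrite !(linear_on0 subsp_setT lA) subr0.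
- by rewrite IH.
- by rewrite IH1 IH2; apply/esym/(linear_onD lC (x := X x) (y := Y x)).
- by rewrite IH; apply/esym/(linear_onZ subsp_setT lC a (x := X x)).
Qed.

Lemma cone_comp X Y : cone X -> cone Y -> cone (fun x => X (Y x)).
Proof.
move=> cX cY; elim: cX => {X} [|| X _ IH | X Z _ IH1 _ IH2 | a X a0 _ IH].
- exact: cone0.
- by [].
- exact: (coneC IH).
- exact: (coneD IH1 IH2).
- exact: (coneZ a0 IH).
Qed.

Lemma cone_selfadjoint X x y : cone X -> <<X x, y>> = <<x, X y>>.
Proof.
move=> cX; elim: cX x y => {X} [|| X cX IH | X Y _ IH1 _ IH2 | a X _ _ IH] x y //=.
- by rewrite dot0l dot0r.
- by rewrite sC IH cone_commC.
- by rewrite dotDl dotDr IH1 IH2.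
- by rewrite dotZl dotZr IH.
Qed.

(** Positivity of [X] alone does not pass to [C X], so the induction carries all the forms <X C^j x,
    x>. For pure powers, <C^(j+2) y, y> = <C^j (C y), C y> reduces to j = 0 and j = 1. *)
Lemma cone_ge0 X x : cone X -> 0 <= <<X x, x>>.
Proof.
have iterC j y z : <<iter j C y, z>> = <<y, iter j C z>>.
  by elim: j z => [|j IH] z //; rewrite (iterSr _ _ z) iterS /= sC IH.
have base j y : 0 <= <<iter j C y, y>>.
  suff: 0 <= <<iter j C y, y>> /\ 0 <= <<iter j.+1 C y, y>> by case.
  elim: j y => [|j IH] y; first by split; [apply: dot_ge0 | apply: C_ge0].
  split; first exact: (IH y).2.
  by rewrite (iterS j.+1) iterSr /= sC; exact: (IH (C y)).1.
move=> cX; suff: forall j, 0 <= <<X (iter j C x), x>> by move=> /(_ 0%N).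
elim: cX => {X} [|| X cX IH | X Y _ IH1 _ IH2 | a X a0 _ IH] j.
- by rewrite dot0l.
- exact: base.
- by rewrite -cone_commC //; exact: (IH j.+1).
- by rewrite dotDl addr_ge0.
- by rewrite dotZl mulr_ge0.
Qed.

Let Y := fix Y n := if n is m.+1 then fun x => 2^-1 *: (C x + Y m (Y m x)) else fun=> 0.

Let half_ge0 : 0 <= 2^-1 :> R. Proof. by rewrite invr_ge0. Qed.

Let coneY n : cone (Y n).
Proof.
elim: n => [|n IH]; first exact: cone0.
exact: (coneZ half_ge0 (coneD (coneC cone_id) (cone_comp IH IH))).
Qed.

Let coneYS n : cone (fun x => Y n.+1 x - Y n x).
Proof.
elim: n => [|n IH].
  have -> : (fun x => Y 1 x - Y 0 x) = fun x => 2^-1 *: C x.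
    by apply/funext => x; rewrite /= addr0 subr0.
  exact: (coneZ half_ge0 (coneC cone_id)).
(* The difference of the squares of [Y n.+1] and [Y n], factored so that both summands are products
   within the cone. *)
have -> : (fun x => Y n.+2 x - Y n.+1 x) =
    fun x => 2^-1 *: ((Y n.+1 (Y n.+1 x) - Y n (Y n.+1 x)) + Y n (Y n.+1 x - Y n x)).
  apply/funext => x; rewrite (linear_onB subsp_setT (cone_linear (coneY n))) //.
  rewrite addrA subrK -[Y n.+2 x]/(2^-1 *: (C x + Y n.+1 (Y n.+1 x))).
  rewrite -[X in _ - X = _]/(2^-1 *: (C x + Y n (Y n x))).
  by rewrite -scalerBr; congr (_ *: _); rewrite opprD addrACA subrr add0r.
apply: (coneZ half_ge0); apply: coneD.
  exact: (cone_comp IH (coneY n.+1)).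
exact: (cone_comp (coneY n) IH).
Qed.

Let coneYd n k : cone (fun x => Y (n + k)%N x - Y n x).
Proof.
elim: k => [|k IH].
  rewrite addn0; have -> : (fun x => Y n x - Y n x) = fun=> 0.
    by apply/funext => x; rewrite subrr.
  exact: cone0.
have -> : (fun x => Y (n + k.+1)%N x - Y n x) =
    fun x => (Y (n + k).+1 x - Y (n + k)%N x) + (Y (n + k)%N x - Y n x).
  by apply/funext => x; rewrite addrA subrK addnS.
exact: coneD (coneYS _) IH.
Qed.

Let nY n x : nrm (Y n x) <= nrm x.
Proof.
elim: n x => [|n IH] x; first by rewrite nrm0 nrm_ge0.
rewrite nrmZ ger0_norm // mulrC ler_pdivrMr //.
apply: le_trans (nrmD _ _ _) _.
have := nC x; have := IH x; have := IH (Y n x); lra.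
Qed.

Let Y_cauchy x : scauchy B (fun n => Y n x).
Proof.
(* Equivalent to <Y_n (Y_(n+k) - Y_n) x, x> >= 0, a product in the cone. Strong convergence thus
   follows from that of the bounded monotone sequence |Y_n x|^2. *)
have main n k : <<Y (n + k)%N x - Y n x, Y (n + k)%N x - Y n x>> <=
    <<Y (n + k)%N x, Y (n + k)%N x>> - <<Y n x, Y n x>>.
  have := cone_ge0 x (cone_comp (coneY n) (coneYd n k)).
  rewrite (cone_selfadjoint _ _ (coneY n)).
  rewrite !dotE (dotC B (Y n x) (Y (n + k)%N x)); lra.
have mono m n : (m <= n)%N -> <<Y m x, Y m x>> <= <<Y n x, Y n x>>.
  by move=> /subnKC <-; rewrite -subr_ge0; apply: le_trans (main _ _); apply: dot_ge0.
have bd n : <<Y n x, Y n x>> <= <<x, x>>.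
  by rewrite -!sqr_nrm ler_pXn2r ?nnegrE ?nrm_ge0.
move=> e e0; have [|N hN] := nondecreasing_bounded_cauchy mono bd (e := e ^+ 2).
  by rewrite exprn_gt0.
have key n k : (N <= n)%N -> nrm (Y (n + k)%N x - Y n x) < e.
  move=> hn; rewrite -(@ltr_pXn2r _ 2) ?nnegrE ?nrm_ge0 ?(ltW e0) // sqr_nrm.
  apply: le_lt_trans (main n k) _; have := hN _ (leq_trans hn (leq_addr k n)).
  have := mono _ _ hn; lra.
exists N => m n hm hn; have [le|le] := leqP m n.
  by rewrite -(subnKC le) nrmB key.
by rewrite -(subnKC (ltnW le)) key.
Qed.

(* [W] is the absolute value of [A], obtained as [1 - Y] where [Y] is the strong limit of
   [Y_0 = 0, Y_(n+1) = (1 - A^2 + Y_n^2) / 2]. *)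
Lemma operator_absolute_value : exists W,
  [/\ linear_on (fun=> True) W, forall x y, <<W x, y>> = <<x, W y>>,
      forall x, 0 <= <<W x, x>>, forall x, W (W x) = A (A x) &
      forall D N, subsp D -> linear_on D N -> closed_on B D N ->
        (forall x, D x -> D (A x) /\ N (A x) = A (N x)) ->
        forall x, D x -> D (W x) /\ N (W x) = W (N x)].
Proof.
have [Z hZ] := exists_choice (fun x => complE (Y_cauchy x)).
have lZ : linear_on (fun=> True) Z.
  move=> a x y _ _; apply: scvg_uniq (hZ _) _.
  under eq_fun do rewrite (cone_linear (coneY _)) //.
  by apply: scvgD; [apply: scvgZ|].
have sZ x y : <<Z x, y>> = <<x, Z y>>.
  apply: (@rcvg_uniq _ (fun n => <<Y n x, y>>)).
    by apply: scvg_dot => //; apply: scvg_cst.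
  under eq_fun do rewrite (cone_selfadjoint _ _ (coneY _)).
  by apply: scvg_dot => //; apply: scvg_cst.
have nZ x : nrm (Z x) <= nrm x by apply: (scvg_nrm_le (nrm_ge0 _ _) (hZ x)).
have ZZ x : Z x + Z x = C x + Z (Z x).
  have h1 : scvg (fun n => Y n (Y n x)) (Z (Z x)).
    have -> : Z (Z x) = 0 + Z (Z x) by rewrite add0r.
    have -> : (fun n => Y n (Y n x)) = fun n => Y n (Y n x - Z x) + Y n (Z x).
      by apply/funext => n; rewrite -(linear_onD (cone_linear (coneY n))) // subrK.
    apply: scvgD; last exact: hZ.
    by apply: (scvg_dominated ler01 _ (hZ x)) => n; rewrite subr0 mul1r.
  have h2 := scvgD (scvg_cst B (C x)) h1.
  apply: scvg_uniq h2; have := scvgZ 2 (scvg_shift (hZ x)); rewrite scaler_nat mulr2n.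
  by congr (scvg _ _); apply/funext => n; rewrite /= scalerA (_ : (1 + 1) / 2 = 1) ?scale1r //; field.
exists (fun x => x - Z x); split.
- by move=> a x y _ _; rewrite lZ // scalerBr opprD addrACA.
- by move=> x y; rewrite !dotE sZ.
- move=> x; rewrite dotDl dotNl subr_ge0 -sqr_nrm expr2.
  by apply: le_trans (dot_le _ _ _) _; rewrite ler_wpM2r ?nrm_ge0.
(* The fixed point equation 2 Z = C + Z^2 rearranges to (1 - Z)^2 = 1 - C = A^2. *)
- move=> x; rewrite (linear_onB subsp_setT lZ) // opprB.
  have -> : A (A x) = x - C x by rewrite opprB addrC subrK.
  have -> : C x = Z x + Z x - Z (Z x) by rewrite ZZ addrK.
  by rewrite opprB opprD !addrA; congr (_ - _); rewrite addrAC.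
- move=> D N sD lN cN comm x Dx.
  have commC u : D u -> D (C u) /\ N (C u) = C (N u).
    move=> Du; have [DAu NAu] := comm _ Du; have [DAAu NAAu] := comm _ DAu.
    by split; [apply: (subspB sD) | rewrite (linear_onB sD lN) // NAAu NAu].
  have commY n : forall u, D u -> D (Y n u) /\ N (Y n u) = Y n (N u).
    elim: n => [|n IH] u Du; first by split; [apply: (subsp0 sD) | apply: (linear_on0 sD lN)].
    have [DCu NCu] := commC _ Du; have [Dv Nv] := IH _ Du; have [Dw Nw] := IH _ Dv.
    split; first by apply: (subspZ sD); apply: (subspD sD).
    rewrite -[LHS]/(N (2^-1 *: (C u + Y n (Y n u)))) (linear_onZ sD lN); last exact: (subspD sD).
    by rewrite (linear_onD lN DCu Dw) NCu Nw Nv.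
  have h1 : scvg (fun n => N (Y n x)) (Z (N x)).
    have -> : (fun n => N (Y n x)) = fun n => Y n (N x).
      by apply/funext => n; rewrite (commY n _ Dx).2.
    exact: hZ.
  have [DZ NZ] := cN _ _ _ (fun n => (commY n _ Dx).1) (hZ x) h1.
  by split; [apply: (subspB sD) | rewrite (linear_onB sD lN) // NZ].
Qed.

End AbsoluteValue.

(** * Spectral subspaces of a normal operator *)

(** Log-convexity makes the ratios of consecutive terms nondecreasing, so a first ratio q > r would
    force b k >= q^k b 0, beyond the bound c r^k. *)
Lemma log_convex_growth (R : realType) (b : nat -> R) r c : 0 < r ->
  (forall k, 0 <= b k) -> (forall k, b k.+1 ^+ 2 <= b k * b k.+2) ->
  (forall k, b k <= c * r ^+ k) -> b 1 <= r * b 0.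
Proof.
move=> r0 b0 cvx bd; rewrite leNgt; apply/negP => h.
have b00 : 0 < b 0.
  rewrite lt_neqAle b0 andbT; apply/eqP => h0; have := cvx 0%N.
  rewrite -h0 mul0r; have := sqr_ge0 (b 1); move: h; rewrite -h0 mulr0 => h1 h2 h3.
  by have := exprn_gt0 2 h1; lra.
pose q := b 1 / b 0.
have rq : r < q by rewrite /q ltr_pdivlMr.
have q0 : 0 < q by lra.
have grow k : 0 < b k /\ q * b k <= b k.+1.
  elim: k => [|k [bk IH]]; first by rewrite /q -mulrA mulVf ?mulr1 ?gt_eqF.
  have bk1 : 0 < b k.+1 by apply: lt_le_trans IH; rewrite mulr_gt0.
  split=> //; rewrite -(ler_pM2l bk); apply: le_trans (cvx k).
  by rewrite mulrCA expr2 mulrA ler_wpM2r // ltW.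
have low k : q ^+ k * b 0 <= b k.
  elim: k => [|k IH]; first by rewrite expr0 mul1r.
  by rewrite exprS -mulrA; apply: le_trans (grow k).2; rewrite ler_wpM2l // ltW.
have t0 : 0 <= r / q by rewrite divr_ge0 ?ltW.
have t1 : r / q < 1 by rewrite ltr_pdivrMr // mul1r.
have [N hN] := rcvg_geometric c t0 t1 b00.
have := hN N (leqnn N); rewrite subr0; apply/negP; rewrite -leNgt.
apply: le_trans (ler_norm _); rewrite expr_div_n mulrA ler_pdivlMr ?exprn_gt0 //.
by rewrite mulrC; apply: le_trans (low N) (bd N).
Qed.

Section NormalPair.
Variables (R : realType) (E : lmodType R) (B : rinner E).
Hypothesis complE : scomplete B.
Local Notation "<< x , y >>" := (dot B x y).
Local Notation nrm := (nrm B).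
Local Notation scvg := (scvg B).

(* [N'] is the adjoint of [N]; the last field says that its domain is no larger than [D]. *)
Record normal_pair (D : E -> Prop) (N N' : E -> E) : Prop := NormalPair {
  np_sub : subsp D;
  np_lin : linear_on D N;
  np_lin' : linear_on D N';
  np_closed : closed_on B D N;
  np_closed' : closed_on B D N';
  np_adj : forall x y, D x -> D y -> <<N x, y>> = <<x, N' y>>;
  np_nrm : forall x, D x -> nrm (N x) = nrm (N' x);
  np_comm : forall x, D x -> D (N x) -> D (N' x) /\ N (N' x) = N' (N x);
  np_dom : forall x, D x -> D (N' x) -> D (N x);
  np_max : forall y z, (forall x, D x -> <<N x, y>> = <<x, z>>) -> D y /\ N' y = z
}.

Variables (D : E -> Prop) (N N' : E -> E).
Hypothesis nN : normal_pair D N N'.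

Let sD := np_sub nN.
Let lN := np_lin nN.
Let lN' := np_lin' nN.

Definition spectral_subspace r x := (forall k, D (iter k N x)) /\
  exists c, forall k, nrm (iter k N x) <= c * r ^+ k.

Local Notation H := spectral_subspace.

Lemma spectral_subspace_dom r x : H r x -> D x.
Proof. by move=> [h _]; apply: (h 0%N). Qed.

Lemma spectral_subspace_op r x : H r x -> H r (N x).
Proof.
move=> [h [c hc]]; split=> [k|]; first by rewrite -iterSr; apply: h.
by exists (c * r) => k; rewrite -iterSr -mulrA -exprS.
Qed.

Lemma spectral_subspace_le r x : 0 < r -> H r x -> nrm (N x) <= r * nrm x.
Proof.
move=> r0 [h [c hc]]; apply: (@log_convex_growth _ (fun k => nrm (iter k N x)) r c) => //.
  by move=> k; apply: nrm_ge0.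
move=> k; rewrite !iterS sqr_nrm.
have Dk : D (N (iter k N x)) := h k.+1.
rewrite (np_adj nN) //; apply: le_trans (dot_le _ _ _) _.
by rewrite (np_nrm nN Dk).
Qed.

(* Together with the previous lemmas this characterizes [spectral_subspace r] as the largest
   subspace of the domain that is invariant under [N] and on which [N] is bounded by [r]. *)
Lemma spectral_subspace_max r (V : E -> Prop) x : 0 < r ->
  (forall v, V v -> [/\ D v, V (N v) & nrm (N v) <= r * nrm v]) -> V x -> H r x.
Proof.
move=> r0 hV; have it k y : V y -> V (iter k N y).
  by move=> Vy; elim: k => //= k /hV[].
move=> Vx; split=> [k|]; first by case: (hV _ (it k x Vx)).
exists (nrm x); elim=> [|k IH]; first by rewrite expr0 mulr1.
have [_ _ h] := hV _ (it k x Vx); rewrite iterS; apply: le_trans h _.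
by rewrite exprS mulrCA ler_wpM2l // ltW.
Qed.

Lemma spectral_subspace_sub r : 0 < r -> subsp (H r).
Proof.
move=> r0; split.
  apply: (@spectral_subspace_max r (fun v => v = 0)) => // v ->.
  by rewrite (linear_on0 sD lN) nrm0 mulr0; split=> //; apply: subsp0.
move=> a x y [hx [c hc]] [hy [d hd]].
have it k : D (iter k N (a *: x + y)) /\ iter k N (a *: x + y) = a *: iter k N x + iter k N y.
  elim: k => [|k [_ IH]] /=; first by split=> //; apply: sD.2; [apply: (hx 0%N) | apply: (hy 0%N)].
  rewrite IH lN //; split=> //; apply: sD.2; [exact: (hx k.+1) | exact: (hy k.+1)].
split=> [k|]; first by case: (it k).
exists (`|a| * c + d) => k; rewrite (it k).2; apply: le_trans (nrmD _ _ _) _.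
rewrite nrmZ mulrDl -mulrA lerD // ler_wpM2l //.
Qed.

(** The constant in the growth condition depends on the vector, so it cannot be passed to the limit.
    Instead the closure of [H r] is shown to be invariant and to keep the bound [r], and maximality
    applies. *)
Lemma spectral_subspace_closed r : 0 < r -> sclosed B (H r).
Proof.
move=> r0 u x hu ux.
pose V y := exists v, (forall n : nat, H r (v n)) /\ scvg v y.
apply: (@spectral_subspace_max r V) => //; last by exists u.
move=> y [v [hv vy]].
have Dv n := spectral_subspace_dom (hv n).
have [z Nvz] : exists z, scvg (fun n => N (v n)) z.
  apply: complE; apply: (scauchy_dominated (ltW r0) _ (scvg_cauchy vy)) => m n.
  rewrite -(linear_onB sD lN) //; apply: spectral_subspace_le => //.
  exact: subspB (spectral_subspace_sub r0) _ _ (hv m) (hv n).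
have [Dy Ny] := np_closed nN Dv vy Nvz; split=> //.
  by exists (fun n => N (v n)); split=> [n|]; [apply: spectral_subspace_op | rewrite Ny].
apply: nrm_le_dot; first exact: ltW.
rewrite Ny; apply: (rcvg_le (scvg_dot Nvz Nvz) (rcvgZ (r ^+ 2) (scvg_dot vy vy))) => n.
by apply: dot_le_nrm; [apply: ltW | apply: spectral_subspace_le].
Qed.

(** The image of [H r] under [N'] is invariant because [N] and [N'] commute there, and |N N' v| =
    |N' N v| = |N N v| <= r |N v| = r |N' v|; maximality applies. *)
Lemma spectral_subspace_adj r x : 0 < r -> H r x -> H r (N' x).
Proof.
move=> r0 hx; apply: (@spectral_subspace_max r (fun y => exists2 v, H r v & y = N' v)) => //.
  move=> _ [v hv ->]; have Dv := spectral_subspace_dom hv.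
  have hNv := spectral_subspace_op hv; have DNv := spectral_subspace_dom hNv.
  have [DN'v e] := np_comm nN Dv DNv; split=> //; first by exists (N v).
  by rewrite e -(np_nrm nN DNv) -(np_nrm nN Dv); apply: spectral_subspace_le.
by exists x.
Qed.

Lemma spectral_subspace_mono r s x : 0 < r -> r <= s -> H r x -> H s x.
Proof.
move=> r0 rs hx; apply: (@spectral_subspace_max s (H r)) => //; first exact: lt_le_trans rs.
move=> v hv; split; [exact: spectral_subspace_dom hv | exact: spectral_subspace_op |].
apply: le_trans (spectral_subspace_le r0 hv) _.
by rewrite ler_wpM2r ?nrm_ge0.
Qed.

Definition spectral_complement r x := forall h, H r h -> <<x, h>> = 0.

Local Notation K := spectral_complement.

Lemma spectral_complement_sub r : subsp (K r).
Proof.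
split=> [h _|a x y hx hy h hh]; first by rewrite dot0l.
by rewrite dotDl dotZl hx // hy // mulr0 addr0.
Qed.

Lemma spectral_complement_closed r : sclosed B (K r).
Proof.
by move=> u x hu ux h hh; apply: (scvg_dot_eq ux (scvg_cst B h)) => n; apply: hu.
Qed.

Lemma spectral_complement_op r x : 0 < r -> D x -> K r x -> K r (N x).
Proof.
move=> r0 Dx hx h hh; rewrite (np_adj nN) //; last exact: spectral_subspace_dom hh.
by apply: hx; apply: spectral_subspace_adj.
Qed.

Lemma spectral_complement_adj r x : D x -> K r x -> K r (N' x).
Proof.
move=> Dx hx h hh; rewrite dotC -(np_adj nN) //; last exact: spectral_subspace_dom hh.
by rewrite dotC; apply: hx; apply: spectral_subspace_op.
Qed.

(** [P] is a (a + N^* N)^-1; the factor [a] makes it a positive contraction for every [a]. *)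
Definition resolvent a (P : E -> E) :=
  forall z, [/\ D (P z), D (N (P z)) & a *: P z + N' (N (P z)) = a *: z].

Lemma resolvent_exists a : 0 < a -> exists P, resolvent a P.
Proof.
move=> a0; apply: (exists_choice (P := fun z x =>
  [/\ D x, D (N x) & a *: x + N' (N x) = a *: z])) => z.
have [x [Dx hx]] := graph_resolvent complE z sD lN (np_closed nN) a0; exists x.
have [|DNx e] := @np_max _ _ _ nN (N x) (a *: (z - x)).
  by move=> h Dh; rewrite dotC -hx // dotZr dotC.
by split=> //; rewrite e scalerBr addrC subrK.
Qed.

Section Resolvent.
Variables (a : R) (P : E -> E).
Hypotheses (a0 : 0 < a) (rP : resolvent a P).

Let DP z : D (P z). Proof. by case: (rP z). Qed.
Let DNP z : D (N (P z)). Proof. by case: (rP z). Qed.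
Let PE z : a *: P z + N' (N (P z)) = a *: z. Proof. by case: (rP z). Qed.

Lemma adj_opP x y : D x -> D (N x) -> D y -> <<N' (N x), y>> = <<N x, N y>>.
Proof. by move=> Dx DNx Dy; rewrite dotC -(np_adj nN) // dotC. Qed.

Lemma resolvent_uniq u z : D u -> D (N u) -> a *: u + N' (N u) = a *: z -> u = P z.
Proof.
move=> Du DNu e; apply/eqP; rewrite -subr_eq0; apply/eqP/(@dot_eq0 _ _ B).
have Dw : D (u - P z) by apply: subspB.
have : <<a *: (u - P z) + N' (N (u - P z)), u - P z>> = 0.
  rewrite (linear_onB sD lN) // (linear_onB sD lN') // scalerBr addrACA -opprD e PE.
  by rewrite subrr dot0l.
rewrite dotDl adj_opP //; last by rewrite (linear_onB sD lN) //; apply: subspB.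
rewrite dotZl; have := dot_ge0 B (N (u - P z)); have := dot_ge0 B (u - P z) => h1 h2 h3.
have : a * <<u - P z, u - P z>> = 0 by have := mulr_ge0 (ltW a0) h1; lra.
by move/eqP; rewrite mulf_eq0 gt_eqF //= => /eqP.
Qed.

Lemma resolvent_linear : linear_on (fun=> True) P.
Proof.
move=> b x y _ _; apply/esym/resolvent_uniq; first exact: sD.2.
  by rewrite lN //; apply: sD.2.
by rewrite lN // lN' // !scalerDr !scalerA mulrC -!scalerA addrACA -scalerDr !PE.
Qed.

Lemma resolvent_form x y : a * <<P x, y>> = a * <<P x, P y>> + <<N (P x), N (P y)>>.
Proof.
rewrite -dotZr -PE dotDr dotZr; congr (_ + _).
by rewrite dotC adj_opP // dotC.
Qed.

Lemma resolvent_selfadjoint x y : <<P x, y>> = <<x, P y>>.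
Proof.
apply: (mulfI (lt0r_neq0 a0)); rewrite resolvent_form (dotC B x) (resolvent_form y x).
by rewrite (dotC B (P y)) (dotC B (N (P y))).
Qed.

Lemma resolvent_sqr_le x : <<P x, P x>> <= <<P x, x>>.
Proof. by rewrite -(ler_pM2l a0) (resolvent_form x x) lerDl dot_ge0. Qed.

Lemma resolvent_le x : nrm (P x) <= nrm x.
Proof.
have [->|n0] := eqVneq (nrm (P x)) 0; first exact: nrm_ge0.
have n1 : 0 < nrm (P x) by rewrite lt_neqAle eq_sym n0 nrm_ge0.
rewrite -(ler_pM2l n1) -expr2 sqr_nrm; apply: le_trans (resolvent_sqr_le x) _.
exact: dot_le.
Qed.

(** [N (P x)] solves the equation that characterizes [P (N x)]. The point is its domain: N^* N P x =
    a (x - P x) lies in [D], hence so does N N P x by normality. *)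
Lemma resolvent_comm x : D x -> P (N x) = N (P x).
Proof.
move=> Dx; apply/esym/resolvent_uniq => //.
  have e : N' (N (P x)) = a *: x - a *: P x by rewrite -PE addrC addKr.
  have DS : D (N' (N (P x))) by rewrite e; apply: subspB => //; apply: subspZ.
  exact: (np_dom nN).
have e : N' (N (P x)) = a *: x - a *: P x by rewrite -PE addrC addKr.
have DS : D (N' (N (P x))) by rewrite e; apply: subspB => //; apply: subspZ.
have DNN := np_dom nN (DNP x) DS.
have [_ <-] := np_comm nN (DNP x) DNN.
rewrite e (linear_onB sD lN (subspZ sD a Dx) (subspZ sD a (DP x))).
by rewrite (linear_onZ sD lN a Dx) (linear_onZ sD lN a (DP x)) addrC subrK.
Qed.

Lemma resolvent_iter_comm k x : (forall j, D (iter j N x)) -> iter k N (P x) = P (iter k N x).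
Proof. by move=> hx; elim: k => //= k ->; rewrite resolvent_comm. Qed.

Lemma resolvent_spectral_subspace r x : H r x -> H r (P x).
Proof.
move=> [hx [c hc]]; split=> [k|]; first by rewrite resolvent_iter_comm.
by exists c => k; rewrite resolvent_iter_comm //; apply: le_trans (resolvent_le _) _.
Qed.

Lemma resolvent_spectral_complement r x : K r x -> K r (P x).
Proof.
move=> hx h hh; rewrite resolvent_selfadjoint; apply: hx.
exact: resolvent_spectral_subspace.
Qed.

End Resolvent.

(** * Lower bound and surjectivity of N^* N on the complement of a spectral subspace *)

Section SpectralGap.
Variables (r : R) (P : E -> E).
Hypotheses (r0 : 0 < r) (rP : resolvent (r ^+ 2) P).

Let a0 : 0 < r ^+ 2. Proof. exact: exprn_gt0. Qed.
Let lP := resolvent_linear a0 rP.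
Let sP := resolvent_selfadjoint a0 rP.

Local Notation A := (fun x => 2 *: P x - x).

(* The range of [A + |A|] lies in [{v | |A| v = A v}], on which [P >= 1/2], hence [|N| <= r];
   so a vector orthogonal to [H r] satisfies [A x = - |A| x]. *)
Lemma spectral_complement_resolvent x : K r x -> 2 * <<P x, x>> <= <<x, x>>.
Proof.
have lA : linear_on (fun=> True) A.
  move=> b u v _ _; rewrite lP // scalerDr opprD addrACA scalerBr; congr (_ + _).
  by rewrite !scalerA mulrC.
have sA u v : <<A u, v>> = <<u, A v>> by rewrite !dotE sP.
have nA u : nrm (A u) <= nrm u.
  rewrite -[leRHS]mul1r; apply: nrm_le_dot => //; rewrite expr1n mul1r.
  have := resolvent_sqr_le a0 rP u; rewrite !dotE (dotC B u); lra.
have [W [lW sW W0 WW commW]] := operator_absolute_value complE lA sA nA.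
have commN u : D u -> D (W u) /\ N (W u) = W (N u).
  apply: (commW _ _ sD lN (np_closed nN)) => v Dv.
  have [DPv DNPv _] := rP v.
  split; first by apply: subspB => //; apply: subspZ.
  rewrite (linear_onB sD lN) ?(linear_onZ sD lN) ?(resolvent_comm a0 rP) //.
  exact: subspZ.
have cP := bounded_closed_on lP ler01
  (fun u => eq_ind_r (fun t => _ <= t) (resolvent_le a0 rP u) (mul1r _)).
have [commP commA] : (forall u, P (W u) = W (P u)) /\ (forall u, A (W u) = W (A u)).
  have cA := bounded_closed_on lA ler01 (fun u => eq_ind_r (fun t => _ <= t) (nA u) (mul1r _)).
  split=> u.
    apply: (commW _ P subsp_setT lP cP _ _ I).2 => v _; split=> //.
    by rewrite (linear_onB subsp_setT lP) // (linear_onZ subsp_setT lP).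
  by apply: (commW _ _ subsp_setT lA cA _ _ I).2.
pose V v := W v = A v.
have sV : subsp V.
  split=> [|b u v]; rewrite /V; first by rewrite (linear_on0 subsp_setT lW) (linear_on0 subsp_setT lA).
  by move=> hu hv; rewrite lW // hu hv -lA.
have VP v : V v -> V (P v).
  rewrite /V => hv; rewrite -commP hv (linear_onB subsp_setT lP) //.
  by rewrite (linear_onZ subsp_setT lP).
have Vhalf v : V v -> <<v, v>> <= 2 * <<P v, v>>.
  by move=> hv; have := W0 v; rewrite hv !dotE; lra.
have cV : sclosed B V.
  move=> u v hu uv; apply/eqP; rewrite -subr_eq0; apply/eqP/(@dot_nondegenerate _ _ B) => y.
  rewrite dotDl dotNl sW sA -dotNr -dotDr.
  apply: (scvg_dot_eq uv (scvg_cst B _)) => n.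
  by rewrite dotDr dotNr -sW -sA -dotNl -dotDl hu subrr dot0l.
have Vbelow v : V v -> 2^-1 * nrm v <= nrm (P v).
  move=> hv; have := Vhalf v hv; rewrite -sqr_nrm => h1; have h2 := dot_le B (P v) v.
  have [->|n0] := eqVneq (nrm v) 0; first by rewrite mulr0 nrm_ge0.
  have n1 : 0 < nrm v by rewrite lt_neqAle eq_sym n0 nrm_ge0.
  by rewrite -(ler_pM2r n1); nra.
have half0 : 0 < 2^-1 :> R by rewrite invr_gt0.
(* Surjectivity of [P] on [V] puts [V] inside the range of the resolvent, hence inside the domain of
   N^* N. *)
have onto := coercive_onto complE sV cV (fun b u v _ _ => lP b I I) VP
  (fun u v _ _ => sP u v) half0 Vbelow.
have VH v : V v -> H r v.
  apply: spectral_subspace_max => // {}v hv.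
  have [w [hw vE]] := onto v hv; have [Dv DNv Sv] := rP w; rewrite vE in Dv DNv Sv.
  split=> //.
    rewrite /V -(commN v Dv).2 hv; have [DPv _ _] := rP v.
    rewrite (linear_onB sD lN) ?(linear_onZ sD lN) ?(resolvent_comm a0 rP) //.
    exact: subspZ.
  apply: nrm_le_dot; first exact: ltW.
  (* Now |N v|^2 = r^2 (<w, v> - <v, v>), so <w, v> <= 2 <v, v> suffices. This follows from <w, w>
     <= 2 <w, v> and the Cauchy-Schwarz inequality. *)
  rewrite -adj_opP // (_ : N' (N v) = r ^+ 2 *: w - r ^+ 2 *: v); last by rewrite -Sv addrC addKr.
  rewrite !dotE; have := Vhalf w hw; rewrite vE (dotC B v w).
  have := sqr_dot_le B w v; have := dot_ge0 B v; have := dot_ge0 B w.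
  move: (dot B w w) (dot B v v) (dot B w v) => ww vv wv h1 h2 h3 h4.
  have h5 : wv <= 2 * vv.
    rewrite leNgt; apply/negP => h6; have h7 : 0 < wv by lra.
    have := ler_wpM2r h2 h4; nra.
  by have := ler_wpM2l (ltW a0) h5; lra.
move=> hx; have : W x + A x = 0.
  apply: (@dot_nondegenerate _ _ B) => y; rewrite dotDl sW sA -dotDr.
  apply: hx; apply: VH; rewrite /V (linear_onD lW) // WW [RHS](linear_onD lA) //.
  by rewrite commA addrC.
move=> /(congr1 (fun t => <<t, x>>)); rewrite !dotE; have := W0 x; lra.
Qed.

(** On [K r] one has P <= 1/2, so 1 - P >= 1/2 is onto. Since N^* N P = r^2 (1 - P), solving (1 - P)
    u = y gives the solution r^-2 P u. *)
Lemma adj_op_onto y : K r y -> exists x, [/\ D x, D (N x), K r x & N' (N x) = y].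
Proof.
move=> hy.
have lQ : linear_on (K r) (fun x => x - P x).
  by move=> b u v _ _; rewrite lP // scalerBr opprD addrACA.
have KP u : K r u -> K r (P u) by exact: (resolvent_spectral_complement a0 rP).
have KQ u : K r u -> K r (u - P u).
  by move=> hu; apply: (subspB (spectral_complement_sub r)) => //; apply: KP.
have sQ u v : K r u -> K r v -> <<u - P u, v>> = <<u, v - P v>> by rewrite !dotE sP.
have half0 : 0 < 2^-1 :> R by rewrite invr_gt0.
have below v : K r v -> 2^-1 * nrm v <= nrm (v - P v).
  move=> /spectral_complement_resolvent h1; have := dot_le B (v - P v) v.
  rewrite !dotE => h2; have h3 := sqr_nrm B v.
  have [->|n0] := eqVneq (nrm v) 0; first by rewrite mulr0 nrm_ge0.
  have n1 : 0 < nrm v by rewrite lt_neqAle eq_sym n0 nrm_ge0.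
  by rewrite -(ler_pM2r n1); nra.
have [u [Ku uE]] := coercive_onto complE (spectral_complement_sub r)
  (@spectral_complement_closed r) lQ KQ sQ half0 below hy.
have [Dx DNx Sx] := rP u.
exists ((r ^+ 2)^-1 *: P u); split.
- exact: subspZ.
- by rewrite (linear_onZ sD lN) //; apply: subspZ.
- by apply: (subspZ (spectral_complement_sub r)); apply: KP.
- rewrite (linear_onZ sD lN) // (linear_onZ sD lN') // -uE.
  have -> : N' (N (P u)) = r ^+ 2 *: (u - P u) by rewrite scalerBr -Sx addrC addKr.
  by rewrite scalerA mulVf ?scale1r // gt_eqF.
Qed.

(** Put s = r^-2 N^* N x, so that x = P (x + s). The inequality 2 <P w, w> <= <w, w> at w = x + s
    expands to <x, x> <= <s, s>. *)
Lemma spectral_complement_below x : D x -> D (N x) -> K r x ->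
  r ^+ 2 * nrm x <= nrm (N' (N x)).
Proof.
move=> Dx DNx hx.
have [DN'x _] := np_comm nN Dx DNx.
have hS : K r (N' (N x)) by apply: spectral_complement_adj => //; apply: spectral_complement_op.
pose w := x + (r ^+ 2)^-1 *: N' (N x).
have hw : K r w.
  by apply: (subspD (spectral_complement_sub r)) => //; apply: (subspZ (spectral_complement_sub r)).
have xE : x = P w.
  apply: (resolvent_uniq a0 rP) => //.
  by rewrite scalerDr scalerA divff ?scale1r // gt_eqF.
have := spectral_complement_resolvent hw; rewrite -xE => h.
rewrite mulrC -ler_pdivlMr // mulrC.
suff : nrm x <= 1 * nrm ((r ^+ 2)^-1 *: N' (N x)).
  by rewrite nrmZ mul1r ger0_norm // invr_ge0 ltW.
apply: nrm_le_dot => //; rewrite expr1n mul1r; move: h; rewrite /w.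
move: (_ *: N' (N x)) => s; rewrite !dotE (dotC B s x); lra.
Qed.

End SpectralGap.

(** As [z] may lie outside D(N^* N), it is replaced by Q z = (1 + N^* N)^-1 z, still orthogonal to
    every [H r]. Then r^2 |Q z| <= |N^* N Q z| for all r forces Q z = 0. *)
Lemma spectral_subspace_dense z : (forall r, 0 < r -> K r z) -> z = 0.
Proof.
move=> hz; have [Q rQ] := resolvent_exists (@ltr01 R).
have [DQ DNQ QE] := rQ z.
suff Q0 : Q z = 0.
  by move: QE; rewrite Q0 (linear_on0 sD lN) (linear_on0 sD lN') !scaler0 addr0 scale1r.
apply/(@nrm_eq0 _ _ B)/eqP; rewrite eq_le nrm_ge0 andbT; apply/ler_addgt0Pr => e e0.
rewrite add0r; pose M := nrm (N' (N (Q z))); have M0 : 0 <= M := nrm_ge0 _ _.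
pose r := 1 + M / e; have Me : 0 <= M / e by rewrite divr_ge0 // ltW.
have r0 : 0 < r by rewrite /r; lra.
have a0 : 0 < r ^+ 2 by rewrite exprn_gt0.
have [P rP] := resolvent_exists a0.
have := spectral_complement_below r0 rP DQ DNQ (resolvent_spectral_complement ltr01 rQ (hz r r0)).
rewrite -/M mulrC -ler_pdivlMr // => h; apply: le_trans h _.
rewrite ler_pdivrMr //; have -> : M = e * (M / e) by field; rewrite gt_eqF.
by rewrite ler_wpM2l ?(ltW e0) // /r; nra.
Qed.
(** The spaces increase with n, their union is dense, and a projection is at least as close to [z]
    as any vector of the space. *)
Lemma spectral_projection_cvg z : exists p : nat -> E,
  (forall n, H n.+1%:R (p n) /\ K n.+1%:R (z - p n)) /\ scvg p z.
Proof.
have n0 n : 0 < n.+1%:R :> R by rewrite ltr0n.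
have [p hp] : exists p : nat -> E, forall n, H n.+1%:R (p n) /\ K n.+1%:R (z - p n).
  apply: (exists_choice (P := fun n p => H n.+1%:R p /\ K n.+1%:R (z - p))) => n.
  exact: (orthogonal_projection complE z (spectral_subspace_sub (n0 n))
    (@spectral_subspace_closed _ (n0 n))).
exists p; split=> //.
pose V y := forall e, 0 < e -> exists n, exists2 h, H n.+1%:R h & nrm (y - h) < e.
have mono m n h : (m <= n)%N -> H m.+1%:R h -> H n.+1%:R h.
  by move=> mn; apply: spectral_subspace_mono => //; rewrite ler_nat ltnS.
have HV r h : 0 < r -> H r h -> V h.
  move=> r0 hh e e0; exists (Num.truncn r); exists h; last by rewrite subrr nrm0.
  by apply: spectral_subspace_mono hh => //; apply/ltW/truncnS_gt.
have sV : subsp V.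
  split; first by apply: (HV 1) => //; apply: subsp0 (spectral_subspace_sub ltr01).
  move=> a x y hx hy e e0; have a1 : 0 < `|a| + 1 by rewrite ltr_wpDl.
  have [|m [h hh h1]] := hx (e / 2 / (`|a| + 1)); first by rewrite !divr_gt0.
  have [|n [k hk k1]] := hy (e / 2); first by rewrite divr_gt0.
  exists (maxn m n), (a *: h + k).
    apply: (spectral_subspace_sub (n0 _)).2; first exact: mono (leq_maxl m n) hh.
    exact: mono (leq_maxr m n) hk.
  rewrite opprD addrACA -scalerBr; apply: le_lt_trans (nrmD _ _ _) _; rewrite nrmZ.
  by move: h1; rewrite ltr_pdivlMr // mulrDr mulr1; have := nrm_ge0 B (x - h); lra.
have cV : sclosed B V.
  move=> u x hu ux e e0; have e2 : 0 < e / 2 by rewrite divr_gt0.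
  have [N0 hN0] := ux _ e2; have [n [h hh h1]] := hu N0 _ e2.
  exists n, h => //; have := nrm_triangle B x (u N0) h.
  by have := hN0 _ (leqnn _); rewrite (nrmB B (u N0) x); lra.
have [q [Vq hq]] := orthogonal_projection complE z sV cV.
have zq : z - q = 0.
  by apply: spectral_subspace_dense => r r0 h hh; apply: hq; apply: (HV r).
move=> e e0; have Vz : V z by move/eqP: zq; rewrite subr_eq0 => /eqP ->.
have [n [h hh h1]] := Vz e e0; exists n => m nm.
rewrite nrmB; apply: le_lt_trans h1; rewrite -[leRHS]mul1r; apply: nrm_le_dot => //.
rewrite expr1n mul1r; have [pm om] := hp m.
have hm : H m.+1%:R (p m - h).
  by apply: subspB (spectral_subspace_sub (n0 m)) _ _ pm _; apply: mono nm hh.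
have -> : z - h = (z - p m) + (p m - h) by rewrite addrA subrK.
move: (om _ hm); move: (z - p m) (p m - h) => s t st.
by rewrite !dotE (dotC B t s) st; have := dot_ge0 B t; lra.
Qed.

Lemma op_onto r y : 0 < r -> K r y -> exists w, [/\ D w, K r w & N w = y].
Proof.
move=> r0 hy; have [P rP] := resolvent_exists (exprn_gt0 2 r0).
have [v [Dv DNv hv Sv]] := adj_op_onto r0 rP hy.
have [DN'v e] := np_comm nN Dv DNv.
by exists (N' v); split=> //; [apply: spectral_complement_adj | rewrite e].
Qed.

End NormalPair.

(** * Complex Hilbert spaces as real ones *)

(** An alias, so that the real and the complex scalar multiplication do not compete on one type.
    Closedness, adjoints and norms of complex operators can all be read off the real part of the
    inner product. *)
Definition realified (R : realType) (H : lmodType R[i]) : Type := H.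

Section Realification.
Variables (R : realType) (H : lmodType R[i]).
HB.instance Definition _ := GRing.Zmodule.copy (realified H) H.

Definition real_scale (a : R) (x : realified H) : realified H := a%:C%C *: (x : H).

Lemma real_scaleA a b x : real_scale a (real_scale b x) = real_scale (a * b) x.
Proof. by rewrite /real_scale scalerA -rmorphM. Qed.

Lemma real_scale1 : left_id 1 real_scale.
Proof. by move=> x; rewrite /real_scale rmorph1 scale1r. Qed.

Lemma real_scaleDr : right_distributive real_scale +%R.
Proof. by move=> a x y; rewrite /real_scale scalerDr. Qed.

Lemma real_scaleDl x : {morph real_scale^~ x : a b / a + b}.
Proof. by move=> a b; rewrite /real_scale rmorphD scalerDl. Qed.

HB.instance Definition _ := GRing.Zmodule_isLmodule.Build R (realified H)
  real_scaleA real_scale1 real_scaleDr real_scaleDl.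

Variable I : inner_product H.

Lemma ipDl x y z : ip I (x + y) z = ip I x z + ip I y z.
Proof. by rewrite -[x]scale1r ip_linl scale1r mul1r. Qed.

Lemma ip0l z : ip I 0 z = 0.
Proof. by apply: (addrI (ip I 0 z)); rewrite -ipDl !addr0. Qed.

Lemma ipZl a x z : ip I (a *: x) z = a * ip I x z.
Proof. by rewrite -[a *: x]addr0 ip_linl ip0l addr0. Qed.

Lemma ipDr x y z : ip I z (x + y) = ip I z x + ip I z y.
Proof. by rewrite ip_conj ipDl rmorphD (ip_conj I z x) (ip_conj I z y). Qed.

Lemma ipZr a x z : ip I z (a *: x) = Num.conj a * ip I z x.
Proof. by rewrite ip_conj ipZl rmorphM (ip_conj I z x). Qed.

Lemma ipNl x z : ip I (- x) z = - ip I x z.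
Proof. by rewrite -scaleN1r ipZl mulN1r. Qed.

Lemma ipNr x z : ip I z (- x) = - ip I z x.
Proof. by rewrite ip_conj ipNl rmorphN (ip_conj I z x). Qed.

Definition real_dot (x y : realified H) : R := complex.Re (ip I x y).

Lemma real_dotDl x y z : real_dot (x + y) z = real_dot x z + real_dot y z.
Proof. by rewrite /real_dot ipDl raddfD. Qed.

Lemma real_dotZl a x z : real_dot (a *: x) z = a * real_dot x z.
Proof. by rewrite /real_dot ipZl; case: (ip I x z) => u v /=; rewrite mul0r subr0. Qed.

Lemma real_dotC x y : real_dot x y = real_dot y x.
Proof. by rewrite /real_dot ip_conj; case: (ip I y x). Qed.

Lemma ipxx x : ip I x x = (complex.Re (ip I x x))%:C%C.
Proof. by rewrite RRe_real // ger0_real ?ip_ge0. Qed.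

Lemma real_dot_ge0 x : 0 <= real_dot x x.
Proof. by rewrite -ler0c -ipxx ip_ge0. Qed.

Lemma real_dot_eq0 x : real_dot x x = 0 -> x = 0.
Proof. by rewrite /real_dot => h; apply: (@ip_eq0 _ _ I); rewrite ipxx h. Qed.

Definition real_inner : rinner (realified H) :=
  RInner real_dotDl real_dotZl real_dotC real_dot_ge0 real_dot_eq0.

Lemma hnormE x : hnorm I x = nrm real_inner x. Proof. by []. Qed.

Definition cmod (a : R[i]) : R := complex.Re `|a|.

Lemma cmodE a : `|a| = (cmod a)%:C%C.
Proof. by rewrite /cmod RRe_real // normr_real. Qed.

Lemma cmod_ge0 a : 0 <= cmod a.
Proof. by rewrite -ler0c -cmodE. Qed.

Lemma cmodM a b : cmod (a * b) = cmod a * cmod b.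
Proof. by apply: complexI; rewrite rmorphM -!cmodE normrM. Qed.

Lemma cmodD a b : cmod (a + b) <= cmod a + cmod b.
Proof. by rewrite -lecR rmorphD -!cmodE ler_normD. Qed.

Lemma cmodN a : cmod (- a) = cmod a.
Proof. by rewrite /cmod normrN. Qed.

Lemma cmod_conj a : cmod (Num.conj a) = cmod a.
Proof. by rewrite /cmod norm_conjC. Qed.

Lemma cmod_real a : 0 <= a -> cmod a%:C%C = a.
Proof. by move=> a0; apply: complexI; rewrite -cmodE ger0_norm // ler0c. Qed.

Lemma cmod_eq0 a : cmod a = 0 -> a = 0.
Proof. by move=> h; apply/eqP; rewrite -normr_eq0 cmodE h. Qed.

Lemma hnorm_ge0 x : 0 <= hnorm I x. Proof. exact: (nrm_ge0 real_inner). Qed.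

Lemma hnormZ a x : hnorm I (a *: x) = cmod a * hnorm I x.
Proof.
rewrite /hnorm ipZl ipZr mulrA -normCK cmodE ipxx -rmorphXn -rmorphM /=.
by rewrite sqrtrM ?sqr_ge0 // sqrtr_sqr ger0_norm ?cmod_ge0.
Qed.

Lemma hnormD x y : hnorm I (x + y) <= hnorm I x + hnorm I y.
Proof. exact: (nrmD real_inner). Qed.

Lemma hnormN x : hnorm I (- x) = hnorm I x.
Proof. exact: (nrmN real_inner). Qed.

Lemma hnormB x y : hnorm I (x - y) <= hnorm I x + hnorm I y.
Proof. by rewrite -(hnormN y) hnormD. Qed.

(** Multiplying [x] by the unimodular [u] makes the inner product real and nonnegative, so the real
    Cauchy-Schwarz inequality applies. *)
Lemma cmod_ip_le x y : cmod (ip I x y) <= hnorm I x * hnorm I y.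
Proof.
have [e|n0] := eqVneq (ip I x y) 0.
  by rewrite e /cmod normr0 mulr_ge0 ?hnorm_ge0.
pose u := Num.conj (ip I x y) / `|ip I x y|.
have u1 : cmod u = 1.
  by apply: complexI; rewrite -cmodE normf_div norm_conjC normr_id divff ?normr_eq0.
have ue : u * ip I x y = `|ip I x y|.
  by rewrite /u mulrAC -(mulrC (ip I x y)) -normCK expr2 mulfK ?normr_eq0.
have := dot_le real_inner (u *: x) y; rewrite -!hnormE hnormZ u1 mul1r.
by rewrite [dot _ _ _]/(complex.Re _) ipZl ue.
Qed.

Lemma ip_hnorm x : ip I x x = (hnorm I x ^+ 2)%:C%C.
Proof. by rewrite [in LHS]ipxx sqr_sqrtr // -ler0c -ipxx ip_ge0. Qed.

End Realification.

(** * Cauchy estimates for polynomials on a circle, without integration *)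

Section PolynomialCauchy.
Variable C : numClosedFieldType.
Implicit Types (p : {poly C}) (rho c : C).

Lemma horner_even_odd p z : p.[z] = (even_poly p).[z ^+ 2] + (odd_poly p).[z ^+ 2] * z.
Proof. by rewrite -{1}[p]poly_even_odd !hornerE !horner_comp !hornerE. Qed.

Lemma sqrtC_circle rho w : 0 <= rho -> `|w| = rho ^+ 2 -> exists2 z, `|z| = rho & z ^+ 2 = w.
Proof.
move=> r0 hw; exists (sqrtC w); last by rewrite sqrtCK.
by apply/eqP; rewrite -(@eqrXn2 _ 2) ?normr_ge0 // -normrX sqrtCK hw.
Qed.

(* The even part of [p] is the mean of [p z] and [p (- z)], and a polynomial in [z ^ 2] of half
   the degree. *)
Lemma poly_mean_value p rho c : 0 <= rho ->
  (forall z, `|z| = rho -> `|p.[z]| <= c) -> `|p.[0]| <= c.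
Proof.
have [m] := ubnP (size p); elim: m p rho => // m IH p rho sp r0 hp.
have [/size1_polyC pE | s1] := leqP (size p) 1.
  by have := hp rho; rewrite pE !hornerC; apply; rewrite ger0_norm.
have -> : p.[0] = (even_poly p).[0] by rewrite !horner_coef0 coef_even_poly.
apply: (IH _ (rho ^+ 2)); rewrite ?exprn_ge0 //.
  by apply: leq_ltn_trans (size_even_poly _) _; move: sp s1; case: (size p) => [|[|n]] //;
    rewrite uphalfE !ltnS; lia.
move=> w /(sqrtC_circle r0)[z hz <-].
rewrite -(ler_pM2l (ltr0n C 2)) -[X in X * `|_|]normr_nat -normrM.
have -> : 2 * (even_poly p).[z ^+ 2] = p.[z] + p.[- z].
  by rewrite (horner_even_odd p z) (horner_even_odd p (- z)) sqrrN; ring.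
rewrite mulr_natl mulr2n; apply: le_trans (ler_normD _ _) _.
by rewrite lerD ?hp // normrN.
Qed.

(** The coefficient is the value at 0 of the odd part, and z times the odd part at z^2 is half of
    p(z) - p(-z); the mean value bound is applied on the circle of radius rho^2. *)
Lemma poly_coef1_le p rho c : 0 <= rho ->
  (forall z, `|z| = rho -> `|p.[z]| <= c) -> `|p`_1| * rho <= c.
Proof.
move=> r0 hp; have -> : `|p`_1| * rho = `|(rho *: odd_poly p).[0]|.
  by rewrite horner_coef0 coefZ coef_odd_poly normrM (ger0_norm r0) mulrC.
apply: (@poly_mean_value _ (rho ^+ 2)); first exact: exprn_ge0.
move=> w /(sqrtC_circle r0)[z hz <-].
rewrite hornerZ normrM (ger0_norm r0) -hz -normrM.
rewrite -(ler_pM2l (ltr0n C 2)) -[X in X * `|_|]normr_nat -normrM.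
have -> : 2 * (z * (odd_poly p).[z ^+ 2]) = p.[z] - p.[- z].
  by rewrite (horner_even_odd p z) (horner_even_odd p (- z)) sqrrN; ring.
rewrite mulr_natl mulr2n; apply: le_trans (ler_normB _ _) _.
by rewrite lerD ?hp // normrN.
Qed.

End PolynomialCauchy.

(** * The bounded Fuglede theorem *)

(** Stands in for the exponential bound on (1 + s)^n: for instance n s <= 1/2 gives (1 + s)^n <=
    2. *)
Lemma bernoulli_le1 (R : realFieldType) (s : R) n : 0 <= s -> (1 + s) ^+ n * (1 - n%:R * s) <= 1.
Proof.
move=> s0; elim: n => [|n IH]; first by rewrite expr0; lra.
apply: le_trans IH; rewrite exprS mulrAC [leRHS]mulrC.
rewrite ler_wpM2r ?exprn_ge0 ?addr_ge0 // -natr1.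
by have := mulr_ge0 (ler0n R n) (sqr_ge0 s); have := sqr_ge0 s; move: n%:R => m; nra.
Qed.

Section BoundedOperators.
Variables (R : realType) (H : lmodType R[i]) (I : inner_product H).
Implicit Types (V W : H -> Prop) (A N : H -> H) (a b : R[i]).
Local Notation n_ := (hnorm I).

Definition lin_closed V := forall a x y, V x -> V y -> V (a *: x + y).

Definition operator_on V A := (forall v, V v -> V (A v)) /\
  forall a x y, V x -> V y -> A (a *: x + y) = a *: A x + A y.

Definition commute_on V A N := forall v, V v -> A (N v) = N (A v).

Definition shift a A v := v + a *: A v.

Section Iterates.
Variables (V : H -> Prop) (lV : lin_closed V).

Lemma operator_onD A x y : operator_on V A -> V x -> V y -> A (x + y) = A x + A y.
Proof. by move=> [_ h] hx hy; have := h 1 x y hx hy; rewrite !scale1r. Qed.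

Lemma operator_on0 A : operator_on V A -> V 0 -> A 0 = 0.
Proof.
move=> oA V0; have := operator_onD oA V0 V0; rewrite addr0 => h.
by apply: (addrI (A 0)); rewrite addr0 -h.
Qed.

Lemma operator_onZ A a x : operator_on V A -> V 0 -> V x -> A (a *: x) = a *: A x.
Proof.
by move=> oA V0 hx; have := oA.2 a x 0 hx V0; rewrite (operator_on0 oA V0) !addr0.
Qed.

Lemma shift_operator_on a A : operator_on V A -> operator_on V (shift a A).
Proof.
move=> [oA lA]; split=> [v hv | b x y hx hy].
  by rewrite /shift addrC; apply: lV => //; apply: oA.
by rewrite /shift lA // !scalerDr !scalerA (mulrC a b) addrACA.
Qed.

Lemma iter_operator_on n A : operator_on V A -> operator_on V (iter n A).
Proof.
move=> [oA lA]; elim: n => [|n [IH1 IH2]]; first by split.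
split=> [v /IH1/oA //|a x y hx hy]; by rewrite !iterS IH2 // lA //; apply: IH1.
Qed.

Lemma shift_commute_on a b A N : V 0 -> operator_on V A -> operator_on V N ->
  commute_on V A N -> commute_on V (shift a A) (shift b N).
Proof.
move=> V0 oA oN cAN v hv; rewrite /shift.
have VA := oA.1 v hv; have VN := oN.1 v hv.
have VZ c x : V x -> V (c *: x) by move=> hx; rewrite -[_ *: _]addr0; apply: lV.
have -> : A (v + b *: N v) = A v + b *: N (A v).
  by rewrite (operator_onD oA hv (VZ b _ VN)) (operator_onZ b oA V0 VN) cAN.
have -> : N (v + a *: A v) = N v + a *: N (A v).
  by rewrite (operator_onD oN hv (VZ a _ VA)) (operator_onZ a oN V0 VA).
by rewrite !scalerDr !scalerA (mulrC b a) !addrA (addrAC v).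
Qed.

Lemma iter_commute_on n A N : operator_on V N -> operator_on V A -> commute_on V A N ->
  commute_on V (iter n A) N.
Proof.
move=> oN oA cAN v hv; elim: n => //= n ->; rewrite cAN //.
exact: (iter_operator_on n oA).1.
Qed.

Lemma iter_comp n A N v : operator_on V A -> operator_on V N -> commute_on V A N -> V v ->
  iter n A (iter n N v) = iter n (fun u => A (N u)) v.
Proof.
move=> oA oN cAN; elim: n v => // n IH v hv.
rewrite [RHS]iterSr -IH; last by apply: oA.1; apply: oN.1.
rewrite iterSr; congr (iter n A _).
have cNA : commute_on V N A by move=> u hu; rewrite cAN.
by rewrite iterSr (iter_commute_on n oA oN cNA (oN.1 _ hv)).
Qed.

Lemma operator_on_comp A N : operator_on V A -> operator_on V N ->
  operator_on V (fun v => A (N v)).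
Proof.
move=> [oA lA] [oN lN]; split=> [v /oN/oA //|a x y hx hy].
by rewrite lN // lA //; apply: oN.
Qed.

Lemma eq_iter_on n A N v : (forall v, V v -> V (A v)) -> (forall v, V v -> A v = N v) -> V v ->
  iter n A v = iter n N v.
Proof.
move=> oA e hv; have Vi k : V (iter k A v) by elim: k => //= k /oA.
by elim: n => //= n <-; rewrite e.
Qed.

Lemma iter_norm_le n A c v : 0 <= c -> (forall v, V v -> V (A v)) ->
  (forall v, V v -> n_ (A v) <= c * n_ v) -> V v -> n_ (iter n A v) <= c ^+ n * n_ v.
Proof.
move=> c0 oA hA hv; have Vi k : V (iter k A v) by elim: k => //= k /oA.
elim: n => [|n IH]; first by rewrite expr0 mul1r.
by rewrite iterS exprS -mulrA; apply: le_trans (hA _ (Vi n)) _; rewrite ler_wpM2l.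
Qed.

Lemma iter_near_id n A s v : 0 <= s -> (forall v, V v -> V (A v)) ->
  (forall v, V v -> n_ (v - A v) <= s * n_ v) -> V v ->
  n_ (v - iter n A v) <= ((1 + s) ^+ n - 1) * n_ v.
Proof.
move=> s0 oA hA hv; have Vi k : V (iter k A v) by elim: k => //= k /oA.
have bound k : n_ (iter k A v) <= (1 + s) ^+ k * n_ v.
  apply: iter_norm_le => //; first by rewrite addr_ge0.
  move=> u hu; have -> : A u = u - (u - A u) by rewrite opprB addrC subrK.
  by apply: le_trans (hnormB _ _ _) _; rewrite mulrDl mul1r lerD2l hA.
elim: n => [|n IH]; first by rewrite /= subrr expr0 subrr mul0r /hnorm ip0l sqrtr0.
rewrite iterS.
have -> : v - A (iter n A v) = (v - iter n A v) + (iter n A v - A (iter n A v)).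
  by rewrite addrA subrK.
apply: le_trans (hnormD _ _ _) _; apply: le_trans (lerD IH (hA _ (Vi n))) _.
have := ler_wpM2l s0 (bound n); rewrite exprS; lra.
Qed.

End Iterates.

Record bounded_normal_pair V (N N' : H -> H) (r : R) : Prop := BoundedNormalPair {
  bn_lin : lin_closed V;
  bn_zero : V 0;
  bn_op : operator_on V N;
  bn_op' : operator_on V N';
  bn_adj : forall x y, V x -> V y -> ip I (N x) y = ip I x (N' y);
  bn_comm : commute_on V N N';
  bn_le : forall x, V x -> n_ (N x) <= r * n_ x;
  bn_le' : forall x, V x -> n_ (N' x) <= r * n_ x
}.

(* Up to a term of order [|a|^2], the product is [1 + (a^* N - a N')] with a skew-adjoint
   bracket, and such an operator is isometric up to second order. *)
Lemma almost_isometry V N N' r a v : 0 <= r -> bounded_normal_pair V N N' r -> V v ->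
  n_ (shift (- a) N' (shift (Num.conj a) N v)) <= (1 + 3 * (cmod a * r) ^+ 2) * n_ v.
Proof.
move=> r0 bN hv; have [lV V0 oN oN' adj cNN leN leN'] := bN.
have VN := oN.1 v hv; have VN' := oN'.1 v hv.
pose t := cmod a * r; have t0 : 0 <= t by rewrite mulr_ge0 ?cmod_ge0.
pose k := Num.conj a *: N v - a *: N' v.
have -> : shift (- a) N' (shift (Num.conj a) N v) = (v + k) - (a * Num.conj a) *: N' (N v).
  rewrite /shift (operator_onD oN') //; last first.
    by rewrite -[_ *: _]addr0; apply: lV.
  rewrite (operator_onZ _ oN') // scalerDr !scalerA !scaleNr mulNr scaleNr.
  by rewrite /k !addrA.
have kle : n_ k <= 2 * t * n_ v.
  apply: le_trans (hnormB _ _ _) _; rewrite !hnormZ cmod_conj /t.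
  have := ler_wpM2l (cmod_ge0 a) (leN v hv); have := ler_wpM2l (cmod_ge0 a) (leN' v hv); lra.
have skew : complex.Re (ip I v k) = 0.
  rewrite /k ipDr ipNr !ipZr conjCK.
  have -> : ip I v (N' v) = Num.conj (ip I v (N v)) by rewrite -adj // ip_conj.
  rewrite -rmorphM; case: (a * ip I v (N v)) => p q /=; ring.
(* Skewness gives |v + k|^2 = |v|^2 + |k|^2 <= (1 + 4 t^2) |v|^2. The remaining term |a|^2 N^* N v
   adds another t^2, whence the constant 3. *)
clearbody k; have vk : n_ (v + k) <= (1 + 2 * t ^+ 2) * n_ v.
  have p0 : 0 <= (1 + 2 * t ^+ 2) * n_ v.
    by apply: mulr_ge0 (hnorm_ge0 _ _); have := sqr_ge0 t; lra.
  rewrite -(@ler_pXn2r _ 2) ?nnegrE ?hnorm_ge0 //.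
  have -> : n_ (v + k) ^+ 2 = n_ v ^+ 2 + n_ k ^+ 2.
    apply: complexI; rewrite rmorphD -!ip_hnorm ipDl !ipDr (ip_conj I k v).
    have e : ip I v k + Num.conj (ip I v k) = 0.
      case: (ip I v k) skew => p q /= ->; apply/eqP; rewrite eq_complex /=.
      by apply/andP; split; apply/eqP; ring.
    by rewrite [Num.conj _ + _]addrC addrACA e addr0 !ip_hnorm.
  have h : n_ k ^+ 2 <= (2 * t * n_ v) ^+ 2.
    by rewrite ler_pXn2r ?nnegrE ?hnorm_ge0 //; apply: le_trans kle; apply: hnorm_ge0.
  have := mulr_ge0 (sqr_ge0 (t ^+ 2)) (sqr_ge0 (n_ v)); move: h; lra.
apply: le_trans (hnormB _ _ _) _; rewrite hnormZ cmodM cmod_conj.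
have h1 : n_ (N' (N v)) <= r * (r * n_ v).
  by apply: le_trans (leN' _ VN) _; rewrite ler_wpM2l ?leN.
have := ler_wpM2l (mulr_ge0 (cmod_ge0 a) (cmod_ge0 a)) h1.
by move: vk; rewrite /t; lra.
Qed.

End BoundedOperators.

Section Fuglede.
Variables (R : realType) (H : lmodType R[i]) (I : inner_product H).
Local Notation n_ := (hnorm I).
Variables (V W : H -> Prop) (N N' M M' T : H -> H) (r c : R).
Hypotheses (r0 : 0 <= r) (c0 : 0 <= c).
Hypotheses (bN : bounded_normal_pair I V N N' r) (bM : bounded_normal_pair I W M M' r).
Hypotheses (VT : forall v, V v -> W (T v))
  (lT : forall a x y, V x -> V y -> T (a *: x + y) = a *: T x + T y)
  (nT : forall v, V v -> n_ (T v) <= c * n_ v)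
  (TN : forall v, V v -> T (N v) = M (T v)).

Let lV := bn_lin bN.
Let lW := bn_lin bM.
Let oN := bn_op bN.
Let oN' := bn_op' bN.
Let oM := bn_op bM.
Let oM' := bn_op' bM.
Let V0 := bn_zero bN.
Let W0 := bn_zero bM.

(** The conjugate on the right compensates the conjugate linearity of [ip] in its second argument,
    so that [F] is a polynomial in [a]. The exponents are separate to allow induction on one at a
    time. *)
Let F a n m x y :=
  ip I (T (iter n (shift (- a) N') x)) (iter m (shift (Num.conj a) M) y).

(** Each new factor multiplies one polynomial by the variable, so the induction on the linear
    coefficient needs the constant one as well. *)
Let F_poly e n m x y : Num.conj e = e -> V x -> W y -> exists p : {poly R[i]},
  [/\ forall z, F (z * e) n m x y = p.[z], p`_0 = ip I (T x) y &
   p`_1 = m%:R * e * ip I (T x) (M y) - n%:R * e * ip I (T (N' x)) y].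
Proof.
move=> ee; elim: n x => [|n IH] x hx hy.
  elim: m y hy => [|m IH] y hy.
    exists (ip I (T x) y)%:P; split; [by move=> z; rewrite hornerC | by rewrite coefC |].
    by rewrite coefC /= !mul0r subrr.
  have [p [pF p0 p1]] := IH y hy; have [q [qF q0 q1]] := IH (M y) (oM.1 _ hy).
  exists (p + (e *: q) * 'X); split.
  - move=> z; rewrite !hornerE -pF -qF /F iterSr.
    have -> : shift (Num.conj (z * e)) M y = Num.conj (z * e) *: M y + y by rewrite addrC.
    have om := iter_operator_on m (shift_operator_on lW (Num.conj (z * e)) oM).
    rewrite om.2 //; last exact: oM.1.
    by rewrite ipDr ipZr conjCK; ring.
  - by rewrite coefD coefMX addr0.
  - rewrite coefD coefMX /= coefZ p1 q0 -natr1; ring.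
have [p [pF p0 p1]] := IH x hx hy; have [q [qF q0 q1]] := IH (N' x) (oN'.1 _ hx) hy.
exists (p - (e *: q) * 'X); split.
- move=> z; rewrite !hornerE -pF -qF /F iterSr.
  have -> : shift (- (z * e)) N' x = - (z * e) *: N' x + x by rewrite addrC.
  have om := iter_operator_on n (shift_operator_on lV (- (z * e)) oN').
  rewrite om.2 //; last exact: oN'.1.
  rewrite lT; [|apply: om.1; exact: oN'.1 | exact: om.1].
  by rewrite ip_linl; ring.
- by rewrite coefB coefMX subr0.
- rewrite coefB coefMX /= coefZ p1 q0 -natr1; ring.
Qed.

(** A crude bound that grows with |a|, n and m; it only starts the halving argument of [F_bound],
    whose limit does not depend on it. *)
Let F_apriori a n m x y : V x -> W y ->
  cmod (F a n m x y) <= (c * (1 + cmod a * r) ^+ n * (1 + cmod a * r) ^+ m) * (n_ x * n_ y).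
Proof.
move=> hx hy; have t0 : 0 <= 1 + cmod a * r by rewrite addr_ge0 ?mulr_ge0 ?cmod_ge0.
have o1 := shift_operator_on lV (- a) oN'; have o2 := shift_operator_on lW (Num.conj a) oM.
have h1 : n_ (iter n (shift (- a) N') x) <= (1 + cmod a * r) ^+ n * n_ x.
  apply: (iter_norm_le n t0 o1.1 _ hx) => v hv.
  apply: le_trans (hnormD _ _ _) _; rewrite hnormZ cmodN mulrDl mul1r lerD2l -mulrA.
  by rewrite ler_wpM2l ?cmod_ge0 ?(bn_le' bN).
have h2 : n_ (iter m (shift (Num.conj a) M) y) <= (1 + cmod a * r) ^+ m * n_ y.
  apply: (iter_norm_le m t0 o2.1 _ hy) => v hv.
  apply: le_trans (hnormD _ _ _) _; rewrite hnormZ cmod_conj mulrDl mul1r lerD2l -mulrA.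
  by rewrite ler_wpM2l ?cmod_ge0 ?(bn_le bM).
have h3 := nT ((iter_operator_on n o1).1 _ hx).
apply: le_trans (cmod_ip_le _ _ _) _.
have -> : c * (1 + cmod a * r) ^+ n * (1 + cmod a * r) ^+ m * (n_ x * n_ y) =
  (c * ((1 + cmod a * r) ^+ n * n_ x)) * ((1 + cmod a * r) ^+ m * n_ y) by ring.
apply: ler_pM; rewrite ?hnorm_ge0 //.
by apply: le_trans h3 _; rewrite ler_wpM2l.
Qed.

Let T_shift a n v : V v ->
  T (iter n (shift (- Num.conj a) N) v) = iter n (shift (- Num.conj a) M) (T v).
Proof.
have o := shift_operator_on lV (- Num.conj a) oN.
elim: n v => // n IH v hv; rewrite !iterSr IH; last exact: o.1.
congr (iter n _ _); rewrite /shift addrC lT //; last exact: oN.1.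
by rewrite TN // addrC.
Qed.

Let adj_shift a n u w : W u -> W w ->
  ip I (iter n (shift (- Num.conj a) M) u) w = ip I u (iter n (shift (- a) M') w).
Proof.
have o := shift_operator_on lW (- Num.conj a) oM.
have o' := shift_operator_on lW (- a) oM'.
elim: n u w => // n IH u w hu hw; rewrite iterSr IH //; last exact: o.1.
rewrite [in RHS]iterS; have := (iter_operator_on n o').1 _ hw.
move: (iter _ _ w) => s hs; rewrite /shift ipDl ipZl ipDr ipZr (bn_adj bM) //.
by rewrite rmorphN.
Qed.

(* Up to the nearly trivial factor [(1 - (a^* N)^2)^n], the left argument is the image of
   [(1 - a N')^n (1 + a^* N)^n], a near isometry; intertwining turns the remaining
   [(1 - a^* N)^n] into the adjoint of the factor missing on the right. *)
Let F_corrected a n x y : V x -> W y -> 3 * (cmod a * r) ^+ 2 * n%:R <= 2^-1 ->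
  cmod (F a n n (iter n (fun v => shift (Num.conj a) N (shift (- Num.conj a) N v)) x) y)
    <= 4 * c * (n_ x * n_ y).
Proof.
move=> hx hy small; set Q := fun v => _.
have ocN := shift_operator_on lV (Num.conj a) oN.
have omN := shift_operator_on lV (- Num.conj a) oN.
have oaN := shift_operator_on lV (- a) oN'.
have ocM := shift_operator_on lW (Num.conj a) oM.
have oaM := shift_operator_on lW (- a) oM'.
have cNN : commute_on V N N by [].
have cN'N : commute_on V N' N by move=> v hv; rewrite (bn_comm bN).
have cM'M : commute_on W M' M by move=> v hv; rewrite (bn_comm bM).
have C1 := shift_commute_on lV (Num.conj a) (- Num.conj a) V0 oN oN cNN.
have C2 := shift_commute_on lV (- a) (Num.conj a) V0 oN' oN cN'N.
have C3 := shift_commute_on lV (- a) (- Num.conj a) V0 oN' oN cN'N.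
have C4 := shift_commute_on lW (- a) (Num.conj a) W0 oM' oM cM'M.
pose L v := shift (- a) N' (shift (Num.conj a) N v).
pose L' v := shift (- a) M' (shift (Num.conj a) M v).
have oL : operator_on V L := operator_on_comp oaN ocN.
have oL' : operator_on W L' := operator_on_comp oaM ocM.
have oQ : operator_on V Q := operator_on_comp ocN omN.
have CL : commute_on V (shift (- Num.conj a) N) L.
  move=> v hv; rewrite /L -C3; last exact: ocN.1.
  by congr (shift _ _ _); rewrite C1.
have CQ : commute_on V (shift (- a) N') Q.
  move=> v hv; rewrite /Q C2; last exact: omN.1.
  by congr (shift _ _ _); rewrite C3.
have QE v : V v -> shift (- a) N' (Q v) = shift (- Num.conj a) N (L v).
  by move=> hv; rewrite CL // /L -C1.
have e1 : iter n (shift (- a) N') (iter n Q x) =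
    iter n (shift (- Num.conj a) N) (iter n L x).
  rewrite (iter_comp n oaN oQ CQ hx) (iter_comp n omN oL CL hx).
  by apply: (eq_iter_on n _ QE hx) => v hv; apply/oaN.1/oQ.1.
have VLx := (iter_operator_on n oL).1 _ hx.
have WGy := (iter_operator_on n ocM).1 _ hy.
rewrite /F e1 T_shift // adj_shift //; last exact: VT.
rewrite (iter_comp n oaM ocM C4 hy) -[fun _ => _]/L'.
pose s := 3 * (cmod a * r) ^+ 2; have s0 : 0 <= s by rewrite mulr_ge0 ?sqr_ge0.
have pow2 : (1 + s) ^+ n <= 2.
  have h1 := bernoulli_le1 n s0; have h2 : 0 <= (1 + s) ^+ n by rewrite exprn_ge0 ?addr_ge0.
  by have := ler_wpM2l h2 small; rewrite -/s; lra.
have s1 : 0 <= 1 + s by rewrite addr_ge0.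
have hL : n_ (iter n L x) <= 2 * n_ x.
  apply: le_trans (iter_norm_le n s1 oL.1 _ hx) _; last by rewrite ler_wpM2r ?hnorm_ge0.
  by move=> v hv; apply: almost_isometry bN hv.
have hL' : n_ (iter n L' y) <= 2 * n_ y.
  apply: le_trans (iter_norm_le n s1 oL'.1 _ hy) _; last by rewrite ler_wpM2r ?hnorm_ge0.
  by move=> v hv; apply: almost_isometry bM hv.
apply: le_trans (cmod_ip_le _ _ _) _.
have -> : 4 * c * (n_ x * n_ y) = (c * (2 * n_ x)) * (2 * n_ y) by ring.
apply: ler_pM; rewrite ?hnorm_ge0 //.
by apply: le_trans (nT VLx) _; rewrite ler_wpM2l.
Qed.

(** Split x = Q^n x + (x - Q^n x): the first part is bounded by 4 c through [F_corrected], the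
    second has norm at most |x| / 2. So a bound K improves to 4 c + K / 2, and iteration leads to
    the fixed point 8 c. *)
Let F_bound a n x y : V x -> W y -> 3 * (cmod a * r) ^+ 2 * n%:R <= 2^-1 ->
  cmod (F a n n x y) <= 8 * c * (n_ x * n_ y).
Proof.
move=> hx hy small.
pose Q v := shift (Num.conj a) N (shift (- Num.conj a) N v).
have oQ : operator_on V Q.
  exact: operator_on_comp (shift_operator_on lV _ oN) (shift_operator_on lV _ oN).
pose s := (cmod a * r) ^+ 2; have s0 : 0 <= s := sqr_ge0 _.
have pow : (1 + s) ^+ n - 1 <= 2^-1.
  have h1 := bernoulli_le1 n s0; have h2 : 0 <= (1 + s) ^+ n by rewrite exprn_ge0 ?addr_ge0.
  by have := ler_wpM2l h2 small; rewrite -/s; lra.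
have near v : V v -> n_ (v - iter n Q v) <= 2^-1 * n_ v.
  move=> hv; apply: le_trans (iter_near_id n s0 oQ.1 _ hv) _; last first.
    by rewrite ler_wpM2r ?hnorm_ge0.
  move=> u hu; have Vu := oN.1 u hu.
  have -> : u - Q u = (Num.conj a * Num.conj a) *: N (N u).
    have om := shift_operator_on lV (- Num.conj a) oN.
    rewrite /Q {1}/shift /shift (operator_onD oN) //; last first.
      by rewrite -[_ *: _]addr0; apply: lV.
    rewrite (operator_onZ _ oN) // scalerDr scalerA !scaleNr mulrN scaleNr.
    by rewrite addrA subrK opprB addrC subrK.
  rewrite hnormZ cmodM cmod_conj.
  have h1 : n_ (N (N u)) <= r * (r * n_ u).
    by apply: le_trans (bn_le bN Vu) _; rewrite ler_wpM2l ?(bn_le bN).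
  have := ler_wpM2l (mulr_ge0 (cmod_ge0 a) (cmod_ge0 a)) h1.
  by rewrite /s; lra.
have half_ge0 : 0 <= 2^-1 :> R by lra.
pose D0 := c * (1 + cmod a * r) ^+ n * (1 + cmod a * r) ^+ n.
have improve j : forall v, V v -> cmod (F a n n v y) <= (8 * c + D0 * (2^-1) ^+ j) * (n_ v * n_ y).
  elim: j => [|j IH] v hv.
    apply: le_trans (F_apriori _ _ _ hv hy) _; rewrite expr0 mulr1 -/D0.
    by rewrite ler_wpM2r ?mulr_ge0 ?hnorm_ge0 // lerDr mulr_ge0.
  have Vq : V (iter n Q v) := (iter_operator_on n oQ).1 _ hv.
  have Vd : V (v - iter n Q v) by rewrite addrC -scaleN1r; apply: lV.
  have -> : F a n n v y = F a n n (iter n Q v) y + F a n n (v - iter n Q v) y.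
    have of_ := iter_operator_on n (shift_operator_on lV (- a) oN').
    have TD u w : V u -> V w -> T (u + w) = T u + T w.
      by move=> hu hw; have := lT 1 hu hw; rewrite !scale1r.
    have vE : v = iter n Q v + (v - iter n Q v) by rewrite addrC subrK.
    rewrite /F {1}vE (operator_onD of_ Vq Vd) TD ?ipDl //; exact: of_.1.
  apply: le_trans (cmodD _ _) _.
  have h1 := F_corrected hv hy small; have h2 := IH _ Vd.
  have D00 : 0 <= D0.
    by rewrite /D0 !mulr_ge0 // exprn_ge0 // addr_ge0 // mulr_ge0 // cmod_ge0.
  have K0 : 0 <= 8 * c + D0 * (2^-1) ^+ j.
    by apply: addr_ge0; apply: mulr_ge0 => //; apply: exprn_ge0.
  have h3 : n_ (v - iter n Q v) * n_ y <= 2^-1 * n_ v * n_ y.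
    by rewrite ler_wpM2r ?hnorm_ge0 ?near.
  have := ler_wpM2l K0 h3; move: h1 h2; rewrite exprS -/Q.
  move: (2^-1 ^+ j) (n_ (v - _)) (cmod _) (cmod _) => p q u w; lra.
have t0 : 0 <= 2^-1 :> R by lra.
have t1 : 2^-1 < 1 :> R by lra.
have := rcvg_geometric (D0 * (n_ x * n_ y)) t0 t1.
move=> /(rcvgD (rcvg_cst (8 * c * (n_ x * n_ y)))); rewrite addr0.
move=> /(rcvg_le (rcvg_cst (cmod (F a n n x y)))); apply=> j.
apply: le_trans (improve j x hx) _; lra.
Qed.

Lemma bounded_fuglede x y : V x -> W y -> ip I (T (N' x)) y = ip I (T x) (M y).
Proof.
move=> hx hy; pose d := ip I (T x) (M y) - ip I (T (N' x)) y.
suff : cmod d = 0 by move=> /cmod_eq0/eqP; rewrite subr_eq0 => /eqP.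
have key rho : 0 < rho -> cmod d * rho <= 8 * c * (n_ x * n_ y).
  (* For |a| = rho / n the smallness condition of [F_bound] reads 3 (rho r)^2 / n <= 1/2. *)
  move=> rho0; pose n := (Num.truncn (6 * (rho * r) ^+ 2)).+1.
  have n0 : 0 < n%:R :> R by rewrite ltr0n.
  have hn : 6 * (rho * r) ^+ 2 < n%:R by rewrite truncnS_gt.
  pose e : R[i] := (n%:R^-1)%:C%C.
  have [|p [pF _ p1]] := @F_poly e n n x y _ hx hy.
    by apply: conj_Creal; apply: ger0_real; rewrite ler0c invr_ge0 ltW.
  have p1d : p`_1 = d.
    rewrite p1 /e -(rmorph_nat (real_complex R)) -rmorphM divff ?gt_eqF // rmorph1 !mul1r.
    by [].
  rewrite -lecR (_ : (cmod d * rho)%:C%C = `|p`_1| * rho%:C%C); last first.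
    by rewrite p1d cmodE rmorphM.
  apply: poly_coef1_le; first by rewrite ler0c ltW.
  move=> z hz; rewrite -pF cmodE lecR; apply: F_bound => //.
  have -> : cmod (z * e) = rho / n%:R.
    rewrite cmodM /e cmod_real ?invr_ge0 ?ltW //; congr (_ * _).
    by apply: complexI; rewrite -cmodE hz.
  have -> : 3 * (rho / n%:R * r) ^+ 2 * n%:R = 3 * (rho * r) ^+ 2 / n%:R.
    by field; rewrite gt_eqF.
  rewrite ler_pdivrMr //; lra.
apply/eqP; rewrite eq_le cmod_ge0 andbT; apply/ler_addgt0Pr => e e0; rewrite add0r.
pose B := 8 * c * (n_ x * n_ y).
have B0 : 0 <= B by rewrite !mulr_ge0 ?hnorm_ge0.
have rho0 : 0 < (B + 1) / e by rewrite divr_gt0 //; lra.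
have := key _ rho0; rewrite -/B mulrA ler_pdivrMr // => h.
have := cmod_ge0 d; nra.
Qed.

End Fuglede.

(** * Normal operators *)

Section Adjoint.
Variables (R : realType) (H : lmodType R[i]) (I : hilbert_space H).
Local Notation B := (real_inner I).
Local Notation E := (realified H).
Local Notation "<< x , y >>" := (dot B x y).

Lemma real_inner_complete : scomplete B.
Proof. exact: hs_complete. Qed.

Lemma linear_op_subsp (S : op_in H) : linear_op S -> @subsp R E (dom S).
Proof. by move=> [h0 [h1 _]]; split=> // a x y; apply: h1. Qed.

Lemma linear_op_linear_on (S : op_in H) : linear_op S -> @linear_on R E (dom S) (op S).
Proof. by move=> [_ [_ h]] a x y; apply: h. Qed.

Lemma linear_opZ (S : op_in H) a x : linear_op S -> dom S x ->
  dom S (a *: x) /\ op S (a *: x) = a *: op S x.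
Proof.
move=> lS hx; have [h0 [h1 h2]] := lS.
have e0 : op S 0 = 0 := linear_on0 (linear_op_subsp lS) (linear_op_linear_on lS).
split; first by rewrite -[a *: x]addr0; apply: h1.
by have := h2 a x 0 hx h0; rewrite e0 !addr0.
Qed.

Variable N : op_in H.
Hypothesis nN : normal_op I N.
Local Notation N' := (adjoint I N).

Let lN : linear_op N. Proof. by case: nN. Qed.

Lemma adjointE y : dom N' y -> adj_rel I N y (op N' y).
Proof. by move=> [z hz]; apply: epsilon_spec; exists z. Qed.

Lemma normal_dense_orthogonal (z : H) : (forall x, dom N x -> ip I x z = 0) -> z = 0.
Proof.
move=> hz; have [_ dN _ _] := nN.
apply: (@nrm_eq0 _ _ B); apply/eqP; rewrite eq_le nrm_ge0 andbT.
apply/ler_addgt0Pr => e e0; rewrite add0r; have [x [Dx hx]] := dN z e e0.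
have [->|n0] := eqVneq (nrm B z) 0; first exact: ltW.
have n1 : 0 < nrm B z by rewrite lt_neqAle eq_sym n0 nrm_ge0.
rewrite -(ler_pM2r n1) -expr2 sqr_nrm.
have -> : <<z, z>> = <<z - x, z>>.
  by rewrite dotDl dotNl [X in _ - X]/(complex.Re _) hz // subr0.
apply: le_trans (dot_le _ _ _) _.
by rewrite ler_wpM2r ?nrm_ge0 // ltW.
Qed.

Lemma adj_rel_uniq y z w : adj_rel I N y z -> adj_rel I N y w -> z = w.
Proof.
move=> hz hw; apply/eqP; rewrite -subr_eq0; apply/eqP/normal_dense_orthogonal => x Dx.
by rewrite ipDr ipNr -hz // -hw // subrr.
Qed.

Lemma adjoint_rel y z : adj_rel I N y z -> dom N' y /\ op N' y = z.
Proof.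
move=> h; have hy : dom N' y by exists z.
by split=> //; apply: adj_rel_uniq (adjointE hy) h.
Qed.

(* Testing against [x] and ['i *: x] recovers the complex identity from its real part. *)
Lemma adjoint_real_rel (y z : E) : (forall x : E, dom N x -> <<op N x, y>> = <<x, z>>) ->
  dom N' y /\ op N' y = z.
Proof.
move=> h; apply: adjoint_rel => x Dx.
have := h x Dx; have [Dix ix] := linear_opZ 'i%C lN Dx; have := h _ Dix.
rewrite ix /= /real_dot !ipZl.
by case: (ip I (op N x) y) (ip I x z) => a b [c d] /=; rewrite !mul0r !mul1r !sub0r => /oppr_inj -> ->.
Qed.

Lemma adjoint_linear : linear_op N'.
Proof.
split; first by exists 0 => x Dx; rewrite (ip_conj I _ 0) (ip_conj I x) !ip0l.
have key a x y : dom N' x -> dom N' y ->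
    adj_rel I N (a *: x + y) (a *: op N' x + op N' y).
  by move=> hx hy u Du; rewrite !ipDr !ipZr (adjointE hx) // (adjointE hy).
split=> a x y hx hy; first by exists (a *: op N' x + op N' y); apply: key.
by have [] := adjoint_rel (key a x y hx hy).
Qed.

Lemma adjoint_closed : @closed_on R E B (dom N') (op N').
Proof.
move=> u x y hu ux uy; apply: adjoint_real_rel => h Dh.
have h1 := scvg_dot (scvg_cst B (op N h : E)) ux.
have h2 := scvg_dot (scvg_cst B (h : E)) uy.
apply: rcvg_uniq h1 _; move: h2; congr (rcvg _ _); apply/funext => n.
by rewrite /= /real_dot (adjointE (hu n)).
Qed.

Let closN : @closed_on R E B (dom N) (op N).
Proof. by case: nN. Qed.

Let sD := linear_op_subsp lN.
Let lD := linear_op_linear_on lN.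
Let sD' := linear_op_subsp adjoint_linear.
Let lD' := linear_op_linear_on adjoint_linear.

Let adjR (x y : E) : dom N x -> dom N' y -> <<op N x, y>> = <<x, op N' y>>.
Proof. by move=> Dx Dy; rewrite /= /real_dot (adjointE Dy). Qed.

Let commN x : dom N x -> dom N' (op N x) ->
  [/\ dom N' x, dom N (op N' x) & op N (op N' x) = op N' (op N x)].
Proof.
move=> h1 h2; have [_ _ _ [_ [h3 h4]]] := nN.
have [h5 h6] := h3 x (conj h1 h2); split=> //.
by have := h4 x (conj h1 h2).
Qed.

Let normE (u : E) : dom N u -> dom N' (op N u) -> nrm B (op N u) = nrm B (op N' u).
Proof.
move=> Du DNu; have [DN'u DNN'u e] := commN Du DNu.
by congr Num.sqrt; rewrite adjR // -e dotC adjR.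
Qed.

Let Z (u : E) := dom N u /\ dom N' (op N u).

Let sZ : @subsp R E Z.
Proof.
split; first by split; [apply: subsp0 sD | rewrite (linear_on0 sD lD); apply: subsp0 sD'].
move=> a x y [h1 h2] [h3 h4]; split; first exact: sD.2.
by rewrite lD //; apply: sD'.2.
Qed.

(** Since the norms of [L1] and [L2] agree on [Z], a sequence there whose [L1]-images converge has
    Cauchy [L2]-images, and closedness of [L2] takes over. It is used in both directions between [N]
    and its adjoint. *)
Let core_transfer (D1 D2 : E -> Prop) (L1 L2 : E -> E) (u : nat -> E) x :
  @linear_on R E D1 L1 -> @subsp R E D1 -> @linear_on R E D2 L2 -> @subsp R E D2 ->
  closed_on B D2 L2 ->
  (forall v, Z v -> [/\ D1 v, D2 v & nrm B (L1 v) = nrm B (L2 v)]) ->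
  (forall n, Z (u n)) -> scvg B u x -> scvg B (fun n => L1 (u n)) (L1 x) ->
  D2 x /\ nrm B (L1 x) = nrm B (L2 x).
Proof.
move=> l1 s1 l2 s2 c2 hZ Zu ux Lux.
have D1u n : D1 (u n) by have [] := hZ _ (Zu n).
have D2u n : D2 (u n) by have [] := hZ _ (Zu n).
have [y L2u] : exists y, scvg B (fun n => L2 (u n)) y.
  apply: real_inner_complete; apply: (scauchy_dominated ler01 _ (scvg_cauchy Lux)) => m n.
  rewrite mul1r -(linear_onB s2 l2) // -(linear_onB s1 l1) //.
  by have [_ _ ->] := hZ _ (subspB sZ (Zu m) (Zu n)).
have [D2x L2x] := c2 _ _ _ D2u ux L2u; split=> //; rewrite L2x.
congr Num.sqrt; apply: rcvg_uniq (scvg_dot Lux Lux) _.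
have -> : (fun n => <<L1 (u n), L1 (u n)>>) = fun n => <<L2 (u n), L2 (u n)>>.
  by apply/funext => n; rewrite -!sqr_nrm; have [_ _ ->] := hZ _ (Zu n).
exact: (scvg_dot L2u L2u).
Qed.

(* [D(N^* N) = D(N N^* )] is a core for both [N] and [N^*], and both graph norms agree on it. *)
Lemma normal_dom_norm (x : E) : (dom N x <-> dom N' x) /\
  (dom N x -> nrm B (op N x) = nrm B (op N' x)).
Proof.
have toN' : dom N x -> dom N' x /\ nrm B (op N x) = nrm B (op N' x).
  move=> Dx; have [u [uP [ux Nux]]] := adjoint_comp_core real_inner_complete sD lD closN Dx.
  have Zu n : Z (u n).
    have [Du [w hw]] := uP n; split=> //.
    by have [] := @adjoint_real_rel (op N (u n)) w (fun h Dh =>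
      etrans (dotC B _ _) (etrans (esym (hw h Dh)) (dotC B _ _))).
  apply: (core_transfer lD sD lD' sD' adjoint_closed _ Zu ux Nux) => v [h1 h2].
  by have [h3 _ _] := commN h1 h2; split=> //; apply: normE.
split; last by move=> /toN'[].
split=> [/toN'[] //|Dx].
have [|u [Zu [ux Nux]]] := @graph_core R E B real_inner_complete (dom N') Z (op N') x
  sD' lD' adjoint_closed sZ (fun u hu => let: And3 h _ _ := commN hu.1 hu.2 in h) _ Dx.
  (* Test against u = (1 + N^* N)^-1 v: by normality <N^* v, N^* u> = <v, N N^* u> = <v, N^* N u> =
     <v, v - u>, so orthogonality gives <v, v> = 0. *)
  move=> v Dv hv; have [u [Du hu]] := graph_resolvent real_inner_complete v sD lD closN ltr01.
  have [|DNu e] := @adjoint_real_rel (op N u) (v - u).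
    by move=> h Dh; rewrite dotC -hu // mul1r dotC.
  have [DN'u DNN'u c] := commN Du DNu.
  have := hv u (conj Du DNu); rewrite (dotC B (op N' v)) -adjR // c e (dotC B (v - u)) -dotDr.
  by rewrite addrC subrK => /dot_eq0.
suff hZ v : Z v -> [/\ dom N' v, dom N v & nrm B (op N' v) = nrm B (op N v)].
  by have [] := core_transfer lD' sD' lD sD closN hZ Zu ux Nux.
by move=> [h1 h2]; have [h3 _ _] := commN h1 h2; split=> //; rewrite normE.
Qed.

Lemma normal_op_pair : @normal_pair R E B (dom N) (op N) (op N').
Proof.
have DE (x : E) : dom N x <-> dom N' x by case: (normal_dom_norm x).
split=> //.
- by move=> a x y /DE hx /DE hy; apply: lD'.
- move=> u x y hu ux uy.
  have [Dx e] := adjoint_closed (fun n => (DE _).1 (hu n)) ux uy.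
  by split=> //; apply/DE.
- by move=> x y Dx /DE Dy; apply: adjR.
- by move=> x; case: (normal_dom_norm x).
- by move=> x Dx /DE h; have [_ h2 h3] := commN Dx h.
- move=> x /DE Dx DN'x; have [_ _ _ [[h _] _]] := nN.
  by have [_ /DE] := h x (conj Dx DN'x).
- by move=> y z /adjoint_real_rel[/DE].
Qed.

End Adjoint.

(** * Unbounded intertwiners *)

Section Intertwining.
Variables (R : realType) (H : lmodType R[i]) (I : hilbert_space H).
Local Notation B := (real_inner I).
Local Notation E := (realified H).
Local Notation "<< x , y >>" := (dot B x y).
Local Notation nrm := (nrm B).

Definition spectral (N : op_in H) (r : R) : E -> Prop :=
  @spectral_subspace R E B (dom N) (op N) r.

Definition cospectral (N : op_in H) (r : R) : E -> Prop :=
  @spectral_complement R E B (dom N) (op N) r.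

Lemma spectral_bounded_normal_pair N r : normal_op I N -> 0 < r ->
  bounded_normal_pair I (spectral N r) (op N) (op (adjoint I N)) r.
Proof.
move=> nN r0; have pN := normal_op_pair nN; have [lN _ _ _] := nN.
have sub := spectral_subspace_sub pN r0.
have dom_ x : spectral N r x -> dom N x := @spectral_subspace_dom _ _ _ _ _ r x.
have opS x : spectral N r x -> spectral N r (op N x) := @spectral_subspace_op _ _ _ _ _ r x.
have opS' x : spectral N r x -> spectral N r (op (adjoint I N) x) :=
  spectral_subspace_adj pN r0.
have le x : spectral N r x -> nrm (op N x) <= r * nrm x :=
  spectral_subspace_le pN r0.
split.
(* The subspace is so far known to be real. The complex multiples [a *: w] form a space invariant
   under [N] with the same bound, so maximality contains them. *)
- move=> a x y hx hy; apply: (subspD sub) => //.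
  apply: (@spectral_subspace_max R E B (dom N) (op N) r
    (fun v : H => exists2 w : H, spectral N r w & v = a *: w) (a *: x : H) r0); last by exists x.
  move=> _ [w hw ->]; have [Dw ->] := linear_opZ a lN (dom_ _ hw).
  split=> //; first by exists (op N w) => //; apply: opS.
  by rewrite -!hnormE !hnormZ mulrCA ler_wpM2l ?cmod_ge0 // !hnormE le.
- exact: subsp0 sub.
- split=> [v /opS //|a x y /dom_ hx /dom_ hy]; by have [_ [_ ->]] := lN.
- split=> [v /opS' //|a x y /dom_ hx /dom_ hy].
  have [_ [_ ->]] := adjoint_linear nN => //; exact/(normal_dom_norm nN _).1.
- by move=> x y /dom_ hx /dom_ hy; rewrite (adjointE (y := y)) //; apply/(normal_dom_norm nN _).1.
- by move=> x hx; have [] := np_comm pN (dom_ _ hx) (dom_ _ (opS _ hx)).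
- exact: le.
- by move=> x hx; rewrite hnormE -(np_nrm pN (dom_ _ hx)) le.
Qed.

Variables (T M N : op_in H).
Hypotheses (lT : linear_op T) (cT : closed_op I T).
Hypotheses (nM : normal_op I M) (nN : normal_op I N).
Hypotheses (NT : forall x, dom N x -> dom T x).
Hypotheses (TN : op_incl (op_comp T N) (op_comp M T)).

Local Notation N' := (op (adjoint I N)).
Local Notation M' := (op (adjoint I M)).

Let pN := normal_op_pair nN.
Let pM := normal_op_pair nM.

Lemma intertwine x : dom N x -> dom T (op N x) ->
  dom M (op T x) /\ op M (op T x) = op T (op N x).
Proof.
move=> Dx DNx; have [_ h] := TN.1 x (conj Dx DNx).
by split=> //; apply: TN.2.
Qed.

(* The closed graph theorem applies to the everywhere defined closed operator [T (1 + N^* N)^-1]. *)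
Lemma relatively_bounded : exists c, 0 <= c /\ forall x : E, dom N x -> dom N (op N x) ->
  nrm (op T x) <= c * nrm (x + N' (op N x) : E).
Proof.
have [P rP] := resolvent_exists (@real_inner_complete _ _ I) pN ltr01.
have lP := resolvent_linear pN ltr01 rP.
have DT z : dom T (P z) by apply: NT; have [] := rP z.
have lTP : @linear_on R E (fun=> True) (fun z => op T (P z)).
  move=> a x y _ _; rewrite lP //.
  exact: (linear_op_linear_on lT).
have cTP : @closed_on R E B (fun=> True) (fun z => op T (P z)).
  move=> u x y _ ux uy; split=> //.
  have cP := bounded_closed_on lP ler01 (fun u => eq_ind_r (fun t => _ <= t)
    (resolvent_le pN ltr01 rP u) (mul1r _)).
  have Pu : scvg B (fun n => P (u n)) (P x).
    apply: (scvg_dominated ler01 _ ux) => n.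
    by rewrite mul1r -(linear_onB subsp_setT lP) // (resolvent_le pN ltr01 rP).
  by have [] := cT (fun n => DT (u n)) Pu uy.
have [c [c0 hc]] := closed_graph (@real_inner_complete _ _ I) lTP cTP.
exists c; split=> // x Dx DNx.
rewrite {1}(resolvent_uniq pN ltr01 rP (u := x) (z := x + N' (op N x)) Dx DNx) //.
by rewrite !scale1r.
Qed.

Lemma spectral_relatively_bounded r : 0 < r -> exists c, 0 <= c /\ forall x : E, spectral N r x ->
  nrm (op T x) <= c * nrm x.
Proof.
move=> r0; have [c [c0 hc]] := relatively_bounded.
have bn := spectral_bounded_normal_pair nN r0.
exists (c * (1 + r * r)); split=> [|x hx]; first by rewrite mulr_ge0 // addr_ge0 // mulr_ge0 // ltW.
have hNx := (bn_op bn).1 _ hx.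
apply: le_trans (hc x (spectral_subspace_dom hx) (spectral_subspace_dom hNx)) _.
rewrite -mulrA ler_wpM2l //; apply: le_trans (nrmD _ _ _) _.
rewrite mulrDl mul1r lerD2l; apply: le_trans (bn_le' bn hNx) _.
by rewrite -mulrA ler_wpM2l ?(ltW r0) // (bn_le bn).
Qed.

Lemma spectral_intertwine r (x : E) : 0 < r -> spectral N r x -> spectral M r (op T x).
Proof.
move=> r0 hx; have [c [c0 hc]] := spectral_relatively_bounded r0.
have hk k : spectral N r (iter k (op N) x).
  by elim: k => //= k; apply: spectral_subspace_op.
have hN k : dom N (iter k (op N) x) := spectral_subspace_dom (hk k).
have e k : iter k (op M) (op T x) = op T (iter k (op N) x).
  by elim: k => //= k ->; have [] := intertwine (hN k) (NT (hN k.+1)).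
split=> [k|]; first by rewrite e; have [] := intertwine (hN k) (NT (hN k.+1)).
have [_ [C hC]] := hx; exists (c * C) => k; rewrite e.
by apply: le_trans (hc _ (hk k)) _; rewrite -mulrA ler_wpM2l //; apply: hC.
Qed.

Lemma spectral_fuglede r (x y : E) : 0 < r -> spectral N r x -> spectral M r y ->
  <<op T (N' x), y>> = <<op T x, op M y>>.
Proof.
move=> r0 hx hy; have [c [c0 hc]] := spectral_relatively_bounded r0.
have h := @bounded_fuglede _ _ I (spectral N r) (spectral M r) _ _ _ _ (op T) r c (ltW r0) c0
  (spectral_bounded_normal_pair nN r0) (spectral_bounded_normal_pair nM r0).
rewrite /= /real_dot h //.
- by move=> v; apply: spectral_intertwine.
- move=> a u v /spectral_subspace_dom/NT hu /spectral_subspace_dom/NT hv.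
  by have [_ [_ ->]] := lT.
- move=> v hv; have Dv := spectral_subspace_dom hv.
  by have [] := intertwine Dv (NT (spectral_subspace_dom (spectral_subspace_op hv))).
Qed.

(* Writing [x = N^2 w] turns [<T x, k>] into [<T w, M^*^2 k>] and gains the factor [(s / r)^2]. *)
Lemma cospectral_orthogonal_core r s (x k : E) : 0 < s -> s < r ->
  dom N x -> dom N (op N x) -> cospectral N r x -> spectral M s k -> <<op T x, k>> = 0.
Proof.
move=> s0 sr Dx DNx hx hk; have r0 : 0 < r := lt_trans s0 sr.
have [c [c0 hc]] := relatively_bounded.
have [P rP] := resolvent_exists (@real_inner_complete _ _ I) pN (exprn_gt0 2 r0).
have below := spectral_complement_below (@real_inner_complete _ _ I) pN r0 rP.
have bM := spectral_bounded_normal_pair nM s0.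
pose q := (s / r) ^+ 2.
have q0 : 0 <= q := sqr_ge0 _.
have key j : forall x k : E, dom N x -> dom N (op N x) -> cospectral N r x -> spectral M s k ->
    `|<<op T x, k>>| <= c * q ^+ j * (nrm x + nrm (N' (op N x))) * nrm k.
  elim: j => [|j IH] {Dx DNx hx hk}x {}k Dx DNx hx hk.
    apply: le_trans (normr_dot_le _ _ _) _; rewrite expr0 mulr1 ler_wpM2r ?nrm_ge0 //.
    by apply: le_trans (hc _ Dx DNx) _; rewrite ler_wpM2l // nrmD.
  have [w [Dw hw wE]] := op_onto (@real_inner_complete _ _ I) pN r0 hx.
  have [v [Dv hv vE]] := op_onto (@real_inner_complete _ _ I) pN r0 hw.
  have DNv : dom N (op N v) by rewrite vE.
  have DNw : dom N (op N w) by rewrite wE.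
  have [MTw TwE] := intertwine Dw (NT DNw).
  have [MTv TvE] := intertwine Dv (NT DNv).
  have hk1 : spectral M s (M' k) := (bn_op' bM).1 _ hk.
  have hk2 : spectral M s (M' (M' k)) := (bn_op' bM).1 _ hk1.
  have -> : <<op T x, k>> = <<op T v, M' (M' k)>>.
    rewrite -wE -TwE (np_adj pM) //; last exact: spectral_subspace_dom hk.
    by rewrite -{1}vE -TvE (np_adj pM) //; apply: spectral_subspace_dom hk1.
  apply: le_trans (IH v _ Dv DNv hv hk2) _.
  (* Both |v| <= |x| / r^2 and |N^* N v| = |x| <= |N^* N x| / r^2, whereas applying M^* twice to k
     costs at most s^2. *)
  have e1 : nrm (N' (op N v)) = nrm x by rewrite vE -(np_nrm pN Dw) wE.
  have h1 := below v Dv DNv hv; rewrite e1 in h1 *.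
  have h2 := below x Dx DNx hx.
  have h3 : nrm (M' (M' k)) <= s ^+ 2 * nrm k.
    apply: le_trans (bn_le' bM hk1) _; rewrite expr2 -mulrA ler_wpM2l ?(ltW s0) //.
    exact: (bn_le' bM hk).
  have -> : c * q ^+ j.+1 * (nrm x + nrm (N' (op N x))) * nrm k =
      (c * q ^+ j) * (((nrm x + nrm (N' (op N x))) / r ^+ 2) * (s ^+ 2 * nrm k)).
    by rewrite exprS /q; field; rewrite gt_eqF.
  rewrite -[leLHS]mulrA ler_wpM2l //; first by apply: mulr_ge0 => //; apply: exprn_ge0.
  apply: ler_pM; rewrite ?addr_ge0 ?nrm_ge0 //.
  by rewrite ler_pdivlMr ?exprn_gt0 //; lra.
have t0 : 0 <= s / r by rewrite divr_ge0 ?ltW.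
have t1 : q < 1.
  by rewrite /q expr_lt1 // ltr_pdivrMr // mul1r.
have := rcvg_geometric (c * (nrm x + nrm (N' (op N x))) * nrm k) q0 t1.
move=> /(rcvg_le (rcvg_cst `|<<op T x, k>>|)) h.
apply/eqP; rewrite -normr_eq0 eq_le normr_ge0 andbT; apply: h => j.
by apply: le_trans (key j x k Dx DNx hx hk) _; rewrite (mulrAC c) (mulrAC _ (q ^+ j)).
Qed.

(** Vectors that are merely in D(T), such as N^* x in the final argument, admit no bound on T x. One
    double inversion x = N^2 v replaces them by a vector of D(N^2). *)
Lemma cospectral_orthogonal r s (x k : E) : 0 < s -> s < r ->
  dom T x -> cospectral N r x -> spectral M s k -> <<op T x, k>> = 0.
Proof.
move=> s0 sr Dx hx hk; have r0 : 0 < r := lt_trans s0 sr.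
have bM := spectral_bounded_normal_pair nM s0.
have [w [Dw hw wE]] := op_onto (@real_inner_complete _ _ I) pN r0 hx.
have [v [Dv hv vE]] := op_onto (@real_inner_complete _ _ I) pN r0 hw.
have DNv : dom N (op N v) by rewrite vE.
have DTw : dom T (op N w) by rewrite wE.
have [MTw TwE] := intertwine Dw DTw.
have [MTv TvE] := intertwine Dv (NT DNv).
have hk1 : spectral M s (M' k) := (bn_op' bM).1 _ hk.
have hk2 : spectral M s (M' (M' k)) := (bn_op' bM).1 _ hk1.
rewrite -wE -TwE (np_adj pM) //; last exact: spectral_subspace_dom hk.
rewrite -{1}vE -TvE (np_adj pM) //; last exact: spectral_subspace_dom hk1.
exact: cospectral_orthogonal_core s0 sr Dv DNv hv hk2.
Qed.

Lemma adjoint_intertwine x : dom N x -> dom T (N' x) ->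
  dom (adjoint I M) (op T x) /\ M' (op T x) = op T (N' x).
Proof.
move=> Dx Dy; set y := N' x.
have cE := @real_inner_complete _ _ I.
have [p [hp pl]] := spectral_projection_cvg cE pM (op T x).
have [q [hq ql]] := spectral_projection_cvg cE pM (op T y).
have n0 n : 0 < n.+1%:R :> R by rewrite ltr0n.
have Dp n : dom M (p n) by apply: spectral_subspace_dom (hp n).1.
have sT := linear_op_subsp lT.
have lT' := linear_op_linear_on lT.
(* Then p_n converges to T x and M^* p_n to T y, so closedness of M^* gives the claim. *)
suff e n : M' (p n) = q n.
  have Mp : scvg B (fun n => M' (p n)) (op T y) by under eq_fun do rewrite e.
  have [DTx ->] := np_closed' pM Dp pl Mp.
  by split=> //; apply/(normal_dom_norm nM _).1.
pose s : R := n.+1%:R; have s0 : 0 < s := n0 n.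
pose r := 2 * s; have sr : s < r by rewrite /r; lra.
have r0 : 0 < r by rewrite /r; lra.
have subM := spectral_subspace_sub pM s0.
have hM'p : spectral M s (M' (p n)) by exact: (spectral_subspace_adj pM s0 (hp n).1).
have [e1 [he1 oe1]] := orthogonal_projection cE x (spectral_subspace_sub pN r0)
  (@spectral_subspace_closed _ _ _ cE _ _ _ pN r r0).
have De1 : dom N e1 := spectral_subspace_dom he1.
have Dxe : dom N (x - e1) by apply: (subspB (np_sub pN)).
have hN'e : spectral N r (N' e1) by exact: (spectral_subspace_adj pN r0 he1).
have DN'e : dom T (N' e1) by apply/NT/(spectral_subspace_dom hN'e).
(* On [e1] this is the bounded theorem at radius r, since H_s(M) lies in H_r(M). On [x - e1] both
   sides vanish, because N^* preserves the complement of H_r(N) and M preserves H_s(M). *)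
have main k : spectral M s k -> <<op T x, op M k>> = <<op T y, k>>.
  move=> hk; have hMk : spectral M s (op M k) := spectral_subspace_op hk.
  have h1 : <<op T (x - e1), op M k>> = 0.
    by apply: cospectral_orthogonal s0 sr _ oe1 hMk; apply: NT.
  have h2 : <<op T (y - N' e1), k>> = 0.
    apply: (cospectral_orthogonal s0 sr _ _ hk); first exact: (subspB sT).
    rewrite -(linear_onB (np_sub pN) (np_lin' pN)) //.
    exact: (spectral_complement_adj pN).
  have h3 : <<op T (N' e1), k>> = <<op T e1, op M k>>.
    apply: (spectral_fuglede r0 he1).
    exact: (spectral_subspace_mono pM s0 (ltW sr) hk).
  move: h1 h2; rewrite (linear_onB sT lT') ?(linear_onB sT lT') //; try exact: NT.
  by rewrite !dotDl !dotNl h3; lra.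
apply/eqP; rewrite -subr_eq0; apply/eqP/(@dot_eq0 _ _ B).
have hd : spectral M s (M' (p n) - q n) by apply: (subspB subM) => //; apply: (hq n).1.
suff orth k : spectral M s k -> <<M' (p n) - q n, k>> = 0 by apply: orth.
move=> hk; have Dk : dom M k := spectral_subspace_dom hk.
have hMk : spectral M s (op M k) := spectral_subspace_op hk.
have e2 : <<M' (p n), k>> = <<p n, op M k>> by rewrite dotC -(np_adj pM) // dotC.
have := (hp n).2 _ hMk; have := (hq n).2 _ hk; have := main _ hk.
by rewrite !dotDl !dotNl e2; lra.
Qed.

End Intertwining.

Theorem theorem3p3 (R : realType) (H : lmodType R[i]) (I : hilbert_space H)
    (T M N : op_in H) :
  linear_op T -> closed_op I T ->
  normal_op I M -> normal_op I N ->
  (forall x, dom N x -> dom T x) ->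
  op_incl (op_comp T N) (op_comp M T) ->
  op_incl (op_comp T (adjoint I N)) (op_comp (adjoint I M) T).
Proof.
move=> lT cT nM nN NT TN.
have main x : dom (adjoint I N) x -> dom T (op (adjoint I N) x) -> dom T x /\
    dom (adjoint I M) (op T x) /\ op (adjoint I M) (op T x) = op T (op (adjoint I N) x).
  move=> /(normal_dom_norm nN x).1 Dx DTx; split; first exact: NT.
  exact: adjoint_intertwine.
split=> x [h1 h2]; have [h3 [h4 h5]] := main x h1 h2; first by split.
exact: h5.
Qed.
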